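(* For every $s\in\omega$, $\textnormal{ASI}(s)\subseteq\textnormal{asi}(s)$. That is, if a coloring problem $(\Pi,\Gamma)$ is solved by some ASI-$s$ algorithm, then every Borel structured graph $G\in\Gamma$ with $\textnormal{asi}(G)\le s$ admits a Borel $\Pi$-coloring.
   Context: All graphs are locally finite. HF denotes the set of hereditarily finite sets, with the discrete topology. A structured graph is a structure in a finite language extending the language of graphs (one binary adjacency relation, interpreted symmetrically and irreflexively). A coloring problem $(\Pi,\Gamma)$ consists of a class $\Gamma$ of structured graphs, closed under isomorphism and such that $G\in\Gamma$ iff every connected component of $G$ is in $\Gamma$, and a class $\Pi$ of functions $V(G)\to\textnormal{HF}$ ($G\in\Gamma$) (called $\Pi$-colorings), closed under pushforward by isomorphisms and such that $c\in\Pi$ iff its restriction to each component is in $\Pi$. An ASI-$s$ algorithm is a function $\mathcal{A}$ which, on input $(H,<,U_0,\dots,U_s,C)$ where $H$ is a finite structured graph, $<$ a linear order on $V(H)$, $U_0,\dots,U_s$ a partition of $V(H)$, and $C\subseteq V(H)$, returns a function $C\to\textnormal{HF}$, such that for any isomorphism $\phi$ of such input structures, $\mathcal{A}(\text{input})=\mathcal{A}(\phi(\text{input}))\circ(\phi\upharpoonright C)$. For a structured graph $G$ with path metric $\rho_G$ and $r\in\omega$, $G^r$ is the graph on $V(G)$ joining distinct $x,y$ with $\rho_G(x,y)\le r$. An ASI-$s$ witness for $G$ with scale $r$ is a partition $U_0,\dots,U_s$ of $V(G)$ such that every connected component of each $G^r\upharpoonright U_i$ is finite. Given such a witness and a linear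 order $<$ on $V(G)$, let $\mathcal{C}$ be the disjoint set of all components of all $G^r\upharpoonright U_i$, and $\tilde G$ the graph on $\mathcal{C}$ joining $C\neq D$ when $\rho_G(C,D)\le r$. For $n\in\omega$, $\mathcal{A}_n[(G,<,U_0,\dots,U_s)]$ colors each $C\in\mathcal{C}$ by $\mathcal{A}(G\upharpoonright W,<\upharpoonright W,U_0\cap W,\dots,U_s\cap W,C)$, where $W=\bigcup\{D\in\mathcal{C}:\rho_{\tilde G}(C,D)\le n\}$. $(\Pi,\Gamma)\in\textnormal{ASI}(s)$ if there are an ASI-$s$ algorithm $\mathcal{A}$ and $n,r\in\omega$ such that for every $G\in\Gamma$, every linear order $<$ on $V(G)$ and every ASI-$s$ witness for $G$ with scale $r$, $\mathcal{A}_n[(G,<,U_0,\dots,U_s)]\in\Pi$. A structured graph is Borel if its vertex set is a Polish space and all its relations are Borel; a coloring $V(G)\to\textnormal{HF}$ is Borel if it is Borel as a function. For a locally finite Borel graph $G$, $\textnormal{asi}(G)$ (asymptotic separation index) is the least $s\in\omega$ such that for every $r\in\omega$, $G$ admits an ASI-$s$ witness with scale $r$ consisting of Borel sets, or $\infty$ if none exists (for structured graphs this refers to the underlying graph). A coloring problem $(\Pi,\Gamma)$ is in the class $\textnormal{asi}(s)$ if every Borel $G\in\Gamma$ with $\textnormal{asi}(G)\le s$ admits a Borel $\Pi$-coloring. *)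

(* Defs.v *)
From HB Require Import structures.
From mathcomp Require Import all_boot all_order all_algebra generic_quotient.
From mathcomp Require Import all_classical all_reals all_analysis.

Set Implicit Arguments.
Unset Strict Implicit.
Unset Printing Implicit Defensive.

Local Open Scope classical_set_scope.

(* A finite rooted tree denotes the set of the sets denoted by its immediate
   subtrees; HF is the quotient by "denotes the same set". *)
Inductive hftree := HFNode of seq hftree.

Fixpoint hftree_encode (t : hftree) : GenTree.tree void :=
  let: HFNode s := t in GenTree.Node 0 (map hftree_encode s).

Fixpoint hftree_decode (t : GenTree.tree void) : hftree :=
  if t is GenTree.Node _ s then HFNode (map hftree_decode s) else HFNode [::].

Lemma hftree_ind_nested (P : hftree -> Prop) :
  (forall s, (forall i, i < size s -> P (nth (HFNode [::]) s i)) ->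
    P (HFNode s)) ->
  forall t, P t.
Proof.
move=> IH; fix rec 1 => -[s]; apply: IH.
elim: s => [|t s IHs]; first by clear rec.
by move=> [_|i]; [exact: (rec t) | exact: IHs].
Qed.

Lemma hftree_encodeK : cancel hftree_encode hftree_decode.
Proof.
elim/hftree_ind_nested => s IH /=; congr HFNode; rewrite -map_comp.
apply: (@eq_from_nth _ (HFNode [::])) => [|i]; rewrite size_map// => lti.
by rewrite (nth_map (HFNode [::]))//= IH.
Qed.

HB.instance Definition _ := Countable.copy hftree (can_type hftree_encodeK).

Fixpoint hfeq (t u : hftree) {struct t} : bool :=
  let: HFNode s := t in let: HFNode s' := u in
  all (fun x => has (hfeq x) s') s && all (fun y => has (hfeq^~ y) s) s'.

Lemma hftree_ind_mem (P : hftree -> Prop) :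
  (forall s, {in s, forall t, P t} -> P (HFNode s)) -> forall t, P t.
Proof.
move=> IH; elim/hftree_ind_nested => s IHs; apply: IH => t.
by move=> /(nthP (HFNode [::]))[i lti <-]; exact: IHs.
Qed.

Lemma hfeqP s s' : reflect
  ({in s, forall x, exists2 y, y \in s' & hfeq x y} /\
   {in s', forall y, exists2 x, x \in s & hfeq x y})
  (hfeq (HFNode s) (HFNode s')).
Proof.
apply: (iffP andP) => -[].
  by move=> /allP h /allP h'; split=> x /[dup] xs; [move/h|move/h'] => /hasP.
by move=> h h'; split; apply/allP => x xs; apply/hasP; [exact: h|exact: h'].
Qed.

Lemma hfeq_refl : reflexive hfeq.
Proof.
by elim/hftree_ind_mem => s IH; apply/hfeqP; split => x xs; exists x => //;
  exact: IH.
Qed.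

Lemma hfeq_sym : symmetric hfeq.
Proof.
suff imp t u : hfeq t u -> hfeq u t by move=> t u; apply/idP/idP; exact: imp.
elim/hftree_ind_mem: t u => s IH [s'] /hfeqP[h h']; apply/hfeqP; split.
- by move=> y /h'[x xs xy]; exists x => //; exact: IH.
- by move=> x /[dup] xs /h[y ys xy]; exists y => //; exact: IH.
Qed.

Lemma hfeq_trans : transitive hfeq.
Proof.
move=> u t; elim/hftree_ind_mem: t u => s IH [s'] [s''].
move=> /hfeqP[h1 h1'] /hfeqP[h2 h2']; apply/hfeqP; split.
- move=> x /[dup] xs /h1[y /h2[z zs yz] xy]; exists z => //.
  exact: IH xy yz.
- move=> z /h2'[y /h1'[x xs xy] yz]; exists x => //.
  exact: IH xy yz.
Qed.

Canonical hfeq_equiv := EquivRel hfeq hfeq_refl hfeq_sym hfeq_trans.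

Definition HF : Type := {eq_quot hfeq_equiv}%qT.

(* [None] stands for infinity. *)
Definition least (P : set nat) : option nat :=
  if pselect (exists n, `[< P n >]) is left h then Some (ex_minn h) else None.

Definition le_fin (x : option nat) (n : nat) : bool :=
  if x is Some m then m <= n else false.

Lemma least_leP P n : le_fin (least P) n <-> exists2 m, m <= n & P m.
Proof.
rewrite /least; case: pselect => [h|h] /=.
  case: ex_minnP => m /asboolP Pm min; split; first by exists m.
  by case=> k kn Pk; apply: leq_trans kn; apply: min; apply/asboolP.
by split=> // -[m _ Pm]; case: h; exists m; apply/asboolP.
Qed.

Section graph.
Context {V : Type}.
Implicit Types (E : V -> V -> Prop) (U A B : set V).

Fixpoint walk E (n : nat) (x y : V) : Prop :=
  if n is m.+1 then exists2 z, E x z & walk E m z y else x = y.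

Definition path_metric E x y : option nat := least [set n | walk E n x y].

Definition path_metric_set E A B : option nat :=
  least [set n | exists x y, [/\ A x, B y & walk E n x y]].

Definition graph_power E (r : nat) (x y : V) : Prop :=
  x <> y /\ le_fin (path_metric E x y) r.

(* The induced subgraph on U, kept as a relation on V; its components are the
   sets [component (graph_restrict E U) x] with x in U. *)
Definition graph_restrict E U (x y : V) : Prop := [/\ U x, U y & E x y].

Definition component E (x : V) : set V := [set y | exists n, walk E n x y].

Definition linear_order (lt : V -> V -> Prop) : Prop :=
  [/\ forall x, ~ lt x x,
      forall x y z, lt x y -> lt y z -> lt x z &
      forall x y, [\/ lt x y, x = y | lt y x]].

(* The pieces of an indexed partition may be empty. *)
Definition is_partition (I : Type) (U : I -> set V) : Prop :=
  trivIset [set: I] U /\ \bigcup_i U i = [set: V].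

End graph.

(* A finite relational language extending the language of graphs; the adjacency
   symbol is left implicit. *)
Record language := Language { symbol : finType; arity : symbol -> nat }.

Record sgraph (L : language) (V : Type) := SGraph {
  adj : V -> V -> Prop;
  adj_sym : forall x y, adj x y -> adj y x;
  adj_irr : forall x, ~ adj x x;
  adj_locally_finite : forall x, finite_set [set y | adj x y];
  rels : forall R : symbol L, set ('I_(arity R) -> V) }.

Arguments rels {L V} _ _.

Section induced.
Context {L : language} {V : Type} (G : sgraph L V) (W : set V).

Definition induced_adj (x y : W) : Prop := adj G (val x) (val y).

Lemma induced_adj_sym x y : induced_adj x y -> induced_adj y x.
Proof. exact: adj_sym. Qed.

Lemma induced_adj_irr x : ~ induced_adj x x.
Proof. exact: adj_irr. Qed.

Lemma induced_adj_locally_finite x : finite_set [set y | induced_adj x y].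
Proof.
apply: (@finite_preimage _ _ [set y | adj G (val x) y] (fun y : W => val y)).
  by move=> y z _ _; exact: val_inj.
exact: adj_locally_finite.
Qed.

Definition induced : sgraph L W :=
  @SGraph L W induced_adj induced_adj_sym induced_adj_irr
    induced_adj_locally_finite
    (fun R => [set v : 'I_(arity R) -> W | rels G R (fun i => val (v i))]).

End induced.

Definition sgraph_iso (L : language) (V V' : Type)
    (G : sgraph L V) (G' : sgraph L V') (f : V -> V') : Prop :=
  [/\ bijective f,
      forall x y, adj G x y <-> adj G' (f x) (f y) &
      forall R v, rels G R v <-> rels G' R (f \o v)].

Record coloring_problem := ColoringProblem {
  Gamma : forall (L : language) (V : Type), sgraph L V -> Prop;
  Pi : forall (L : language) (V : Type), sgraph L V -> (V -> HF) -> Prop;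
  Gamma_iso : forall L V V' (G : sgraph L V) (G' : sgraph L V') f,
    sgraph_iso G G' f -> Gamma G -> Gamma G';
  Gamma_components : forall L V (G : sgraph L V),
    Gamma G <-> forall x, Gamma (induced G (component (adj G) x));
  Pi_Gamma : forall L V (G : sgraph L V) c, Pi G c -> Gamma G;
  (* c' is the pushforward along f of c' \o f *)
  Pi_iso : forall L V V' (G : sgraph L V) (G' : sgraph L V') f (c' : V' -> HF),
    sgraph_iso G G' f -> Pi G (c' \o f) -> Pi G' c';
  Pi_components : forall L V (G : sgraph L V) (c : V -> HF),
    Pi G c <-> forall x,
      Pi (induced G (component (adj G) x)) (fun y => c (val y)) }.

Record asi_input (L : language) (s : nat) (V : Type) := AsiInput {
  in_graph : sgraph L V;
  in_finite : finite_set [set: V];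
  in_lt : V -> V -> Prop;
  in_linear : linear_order in_lt;
  in_part : 'I_s.+1 -> set V;
  in_partition : is_partition in_part;
  in_set : set V }.

Definition asi_input_iso (L : language) (s : nat) (V V' : Type)
    (I : asi_input L s V) (J : asi_input L s V') (f : V -> V') : Prop :=
  [/\ sgraph_iso (in_graph I) (in_graph J) f,
      forall x y, in_lt I x y <-> in_lt J (f x) (f y),
      forall i x, in_part I i x <-> in_part J i (f x) &
      forall x, in_set I x <-> in_set J (f x)].

Record asi_algorithm (s : nat) := AsiAlgorithm {
  asi_run : forall (L : language) (V : Type) (I : asi_input L s V),
    in_set I -> HF;
  asi_run_iso : forall (L : language) (V V' : Type)
    (I : asi_input L s V) (J : asi_input L s V') (f : V -> V'),
    asi_input_iso I J f ->
    forall (x : in_set I) (y : in_set J), f (val x) = val y ->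
    asi_run x = asi_run y }.

Section witness.
Context {L : language} {V : Type} (G : sgraph L V) {s : nat} (r : nat)
  (U : 'I_s.+1 -> set V).

Definition piece_graph (i : 'I_s.+1) : V -> V -> Prop :=
  graph_restrict (graph_power (adj G) r) (U i).

Definition asi_witness : Prop :=
  is_partition U /\
  forall i x, U i x -> finite_set (component (piece_graph i) x).

Definition cells : set (set V) :=
  [set C | exists i x, U i x /\ C = component (piece_graph i) x].

Definition cell_graph (C D : set V) : Prop :=
  [/\ cells C, cells D, C <> D & le_fin (path_metric_set (adj G) C D) r].

Definition cell_nbhd (n : nat) (C : set V) : set V :=
  \bigcup_(D in [set D | cells D /\ le_fin (path_metric cell_graph C D) n]) D.

Definition cell_of (x : V) : set V :=
  [set y | exists2 i, U i x & component (piece_graph i) x y].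

Lemma walk_ball_finite n (A : set V) : finite_set A ->
  finite_set [set y | exists2 x, A x & walk (adj G) n x y].
Proof.
elim: n A => [|n IH] A finA.
  by apply: sub_finite_set finA => y [x Ax /= <-].
have finB : finite_set (\bigcup_(x in A) [set y | adj G x y]).
  by apply: bigcup_finite => // x _; exact: adj_locally_finite.
apply: sub_finite_set (IH _ finB) => y [x Ax [z xz zy]].
by exists z => //; exists x.
Qed.

Context (witU : asi_witness).

Lemma cell_ofE i x : U i x -> cell_of x = component (piece_graph i) x.
Proof.
move=> Uix; apply/seteqP; split=> y; last by exists i.
case=> j Ujx; suff -> : j = i by [].
have [[triv _] _] := witU.
by apply: triv => //; exists x.
Qed.

Lemma cells_cell_of x : cells (cell_of x).
Proof.
have [[_ cov] _] := witU.
have [i _ Uix] : (\bigcup_i U i) x by rewrite cov.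
by exists i, x; split => //; exact: cell_ofE.
Qed.

Lemma cell_of_self x : cell_of x x.
Proof.
have [[_ cov] _] := witU.
have [i _ Uix] : (\bigcup_i U i) x by rewrite cov.
by exists i => //; exists 0.
Qed.

Lemma piece_walk_sym i n x y :
  walk (piece_graph i) n x y -> component (piece_graph i) y x.
Proof.
have sym_walk m a b : walk (adj G) m a b -> walk (adj G) m b a.
  have snoc k p q t : walk (adj G) k p q -> adj G q t -> walk (adj G) k.+1 p t.
    elim: k p => [|k IHk] p /=; first by move=> -> qt; exists t.
    by move=> [w pw wq] qt; exists w => //; exact: IHk wq qt.
  elim: m a => [|m IHm] a /=; first by [].
  by move=> [c ac cb]; apply: (snoc m b c a) (IHm _ cb) _; exact: adj_sym.
have sym a b : piece_graph i a b -> piece_graph i b a.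
  case=> Ua Ub [ab /least_leP[m mr w]]; split=> //; split; first exact: nesym.
  by apply/least_leP; exists m => //; exact: sym_walk.
elim: n x => [|n IH] x /=; first by move=> ->; exists 0.
move=> [z xz /IH[m yz]]; exists m.+1.
elim: m {IH} y yz => [|m IHm] y /=.
  by move=> ->; exists x => //; exact: sym.
by move=> [w yw wz]; exists w => //; exact: IHm.
Qed.

Lemma walk_cat (E : V -> V -> Prop) n m x y z :
  walk E n x y -> walk E m y z -> walk E (n + m) x z.
Proof.
elim: n x => [|n IH] x /=; first by move=> ->.
by move=> [w xw wy] yz; exists w => //; exact: IH.
Qed.

Lemma cells_memE C x : cells C -> C x -> C = cell_of x.
Proof.
move=> [i [y [Uiy ->]]] [n yx].
have Uix : U i x.
  elim: n y Uiy yx => [|n IH] y Uiy /=; first by move=> <-.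
  by move=> [z [_ Uiz _]]; exact: IH.
rewrite (cell_ofE Uix); apply/seteqP; split=> z [m h].
  have [k xy] := piece_walk_sym yx.
  by exists (k + m); exact: walk_cat xy h.
by exists (n + m); exact: walk_cat yx h.
Qed.

Lemma cells_finite C : cells C -> finite_set C.
Proof. by move=> [i [x [Uix ->]]]; have [_] := witU; exact. Qed.

Lemma cell_graph_finite C : cells C -> finite_set [set D | cell_graph C D].
Proof.
move=> cC; have finB : finite_set
    (\bigcup_(k in `I_r.+1) [set y | exists2 x, C x & walk (adj G) k x y]).
  apply: bigcup_finite; first exact: finite_II.
  by move=> k _; apply: walk_ball_finite; exact: cells_finite.
apply: sub_finite_set (finite_image cell_of finB).
move=> D [_ cD _ /least_leP[k kr [x [y [Cx Dy w]]]]].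
exists y; last exact/esym/cells_memE.
by exists k => //; exists x.
Qed.

Lemma cell_walk_finite n C : cells C ->
  finite_set [set D | walk cell_graph n C D].
Proof.
elim: n C => [|n IH] C cC.
  by apply: sub_finite_set (finite_set1 C) => D /= ->.
have finB : finite_set (\bigcup_(D in [set D | cell_graph C D])
    [set D' | walk cell_graph n D D']).
  apply: bigcup_finite; first exact: cell_graph_finite.
  by move=> D [_ cD _ _]; exact: IH.
by apply: sub_finite_set finB => D' [D CD DD']; exists D.
Qed.

Lemma cell_nbhd_finite n C : cells C -> finite_set (cell_nbhd n C).
Proof.
move=> cC; apply: bigcup_finite; last by move=> D [cD _]; exact: cells_finite.
have finB : finite_set (\bigcup_(k in `I_n.+1) [set D | walk cell_graph k C D]).
  apply: bigcup_finite; first exact: finite_II.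
  by move=> k _; exact: cell_walk_finite.
apply: sub_finite_set finB => D [_ /least_leP[k kn w]].
by exists k.
Qed.

Lemma cell_nbhd_self n x : cell_nbhd n (cell_of x) x.
Proof.
exists (cell_of x); last exact: cell_of_self.
split; first exact: cells_cell_of.
by apply/least_leP; exists 0.
Qed.

Context (n : nat) (lt : V -> V -> Prop) (linlt : linear_order lt).

Section local_input.
Context (C : set V) (cC : cells C).
Let W := cell_nbhd n C.

Lemma local_finite : finite_set [set: W].
Proof.
have := @finite_preimage _ _ W (fun y : W => val y)
  (fun y z _ _ e => val_inj e) (cell_nbhd_finite n cC).
by apply: sub_finite_set => y _; exact: (set_mem (valP y)).
Qed.

Lemma local_linear : linear_order (fun x y : W => lt (val x) (val y)).
Proof.
case: linlt => irr tr tot; split=> [x|x y z|x y]; [exact: irr|exact: tr|].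
by case: (tot (val x) (val y)); [constructor 1|move/val_inj; constructor 2|
  constructor 3].
Qed.

Lemma local_partition : is_partition (fun i => [set x : W | U i (val x)]).
Proof.
have [[triv cov] _] := witU; split.
  by move=> i j _ _ [x [Ui Uj]]; apply: triv => //; exists (val x).
apply/seteqP; split=> // x _.
have [i _ Ui] : (\bigcup_i U i) (val x) by rewrite cov.
by exists i.
Qed.

Definition local_input : asi_input L s W :=
  AsiInput (induced G W) local_finite local_linear local_partition
    [set x : W | C (val x)].

End local_input.

Definition cell_point (x : V) : in_set (local_input (cells_cell_of x)) :=
  exist _ (exist _ x (mem_set (@cell_nbhd_self n x)))
    (mem_set (cell_of_self x)).

Definition asi_coloring (A : asi_algorithm s) (x : V) : HF :=
  asi_run A (cell_point x).

End witness.

Definition ASI (s : nat) (P : coloring_problem) : Prop :=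
  exists (A : asi_algorithm s) (n r : nat),
  forall (L : language) (V : Type) (G : sgraph L V), Gamma P G ->
  forall (lt : V -> V -> Prop) (linlt : linear_order lt)
    (U : 'I_s.+1 -> set V) (witU : asi_witness G r U),
  Pi P G (asi_coloring witU n linlt A).

Definition polish (R : realType) (T : topologicalType) : Prop :=
  (exists2 D : set T, countable D & dense D) /\
  exists d : T -> T -> R,
  [/\ [/\ forall x y, d x y = 0%R <-> x = y,
          forall x y, d x y = d y x &
          forall x y z, (d x z <= d x y + d y z)%R],
      forall A : set T, open A <->
        forall x, A x -> exists2 e : R, (0 < e)%R &
          forall y, (d x y < e)%R -> A y &
      forall u : nat -> T,
        (forall e : R, (0 < e)%R -> exists N, forall m n,
           N <= m -> N <= n -> (d (u m) (u n) < e)%R) ->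
        exists l, forall e : R, (0 < e)%R -> exists N, forall n,
          N <= n -> (d (u n) l < e)%R].

Definition borel (T : topologicalType) : set (set T) :=
  <<s [set A : set T | open A] >>.

Definition borel_sgraph (L : language) (T : topologicalType)
    (G : sgraph L T) : Prop :=
  borel [set p : T * T | adj G p.1 p.2] /\
  forall R : symbol L, @borel {ptws 'I_(arity R) -> T} (rels G R).

(* HF is discrete, so each A : set HF is open. *)
Definition borel_coloring (T : topologicalType) (c : T -> HF) : Prop :=
  forall A : set HF, borel (c @^-1` A).

Definition asi_number (L : language) (T : topologicalType) (G : sgraph L T) :
    option nat :=
  least [set s | forall r, exists U : 'I_s.+1 -> set T,
    asi_witness G r U /\ forall i, borel (U i)].

Definition asi (R : realType) (s : nat) (P : coloring_problem) : Prop :=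
  forall (L : language) (T : topologicalType) (G : sgraph L T),
  polish R T -> borel_sgraph G -> Gamma P G -> le_fin (asi_number G) s ->
  exists2 c : T -> HF, borel_coloring c & Pi P G c.

(* Main.v *)
Require Import Defs.
From mathcomp Require Import all_boot all_order all_algebra.
From mathcomp Require Import all_classical all_reals all_analysis.
From mathcomp Require Import lra.

Set Implicit Arguments.
Unset Strict Implicit.
Unset Printing Implicit Defensive.

Import Order.TTheory GRing.Theory Num.Theory.
Local Open Scope classical_set_scope.

(** In a locally finite Borel graph every point reachable from a vertex [x] is
    the value at [x] of one of countably many Borel functions (Lusin-Novikov),
    so quantifying over reachable points preserves Borelness.  Hence the
    relation "[y] belongs to the neighbourhood fed to the algorithm at [x]" is
    Borel, and so is the statement that a given finite list of these functions
    enumerates that neighbourhood.  Once the list is fixed, finitely many Borel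
    conditions on [x] determine the input of the algorithm up to isomorphism,
    and therefore the color of [x].  The vertices are ordered lexicographically
    through a Borel coding of the space by points of Baire space.

    For the finite-section case of Lusin-Novikov, call [(x, y)] crowded at
    level [n] when another point of the section of [x] has the same first [n]
    digits as [y].  The sets of crowded pairs are analytic, and their
    intersection is empty because sections are finite, so by Novikov's
    separation theorem they have Borel supersets [B n] with empty intersection.
    Off [B n], a point of a section is determined by its first [n] digits: the
    relation is a countable union of analytic partial functions, each of which
    extends to a Borel function by separating the values of its digits. *)

(** * Topological preliminaries *)

Lemma exists2_choice (X Y : Type) (P Q : X -> Y -> Prop) :
  (forall x, exists2 y, P x y & Q x y) ->
  exists2 f : X -> Y, forall x, P x (f x) & forall x, Q x (f x).
Proof.
move=> ex; have /choice[f fPQ] : forall x, exists y, P x y /\ Q x y.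
  by move=> x; have [y] := ex x; exists y.
by exists f => x; have [] := fPQ x.
Qed.

Lemma continuous_funcomp (X Y Z : topologicalType) (f : X -> Y) (g : Y -> Z) :
  continuous f -> continuous g -> continuous (g \o f).
Proof. by move=> cf cg x; apply: continuous_comp; [exact: cf|exact: cg]. Qed.

Lemma continuous_pair (X Y Z : topologicalType) (f : X -> Y) (g : X -> Z) :
  continuous f -> continuous g -> continuous (fun x => (f x, g x)).
Proof. by move=> cf cg x; exact: (cvg_pair (cf x) (cg x)). Qed.

Lemma continuous_fst (X Y : topologicalType) : continuous (@fst X Y).
Proof. by move=> p; exact: cvg_fst. Qed.

Lemma continuous_snd (X Y : topologicalType) : continuous (@snd X Y).
Proof. by move=> p; exact: cvg_snd. Qed.

Lemma second_countableP (T : topologicalType) : @second_countable T <->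
  exists2 B : nat -> set T, (forall n, open (B n)) &
    forall A x, nbhs x A -> exists2 n, B n x & B n `<=` A.
Proof.
split=> [[B /countable_injP[f injf] [Bo Bx]]|[B Bo Bx]].
  exists (fun n => \bigcup_(U in [set U | B U /\ f U = n]) U) => [n|A x].
    by apply: bigcup_open => U [/Bo].
  move=> /Bx[U [BU Ux] UA]; exists (f U) => [|y [W [BW fWU] Wy]].
    by exists U.
  by apply: UA; rewrite -(injf W U) ?inE.
exists (range B).
  exact: (sub_countable (card_image_le _ _) (countableP _)).
split=> [_ [n _ <-]//|x A /Bx[n Bnx BnA]].
by exists (B n) => //; split=> //; exists n.
Qed.

Lemma second_countable_nat : @second_countable nat.
Proof.
apply/second_countableP; exists (fun n => [set n]).
  by move=> n; exact: discrete_open.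
by move=> A n /nbhs_singleton An; exists n => // _ ->.
Qed.

Lemma nbhs_ptws (I : choiceType) (T : topologicalType) (v : {ptws I -> T})
    (O : set {ptws I -> T}) : nbhs v O ->
  exists (s : seq I) (A : I -> set T), (forall i, open_nbhs (v i) (A i)) /\
    forall w : {ptws I -> T}, {in s, forall i, A i (w i)} -> O w.
Proof.
pose boxes : set_system {ptws I -> T} := filter_from
  [set sA : seq I * (I -> set T) | forall i, open_nbhs (v i) (sA.2 i)]
  (fun sA => [set w | {in sA.1, forall i, sA.2 i (w i)}]).
have boxes_filter : Filter boxes.
  apply: filter_from_filter.
    by exists ([::], fun=> setT) => i; exact: open_nbhsT.
  move=> [s A] [t B] As Bt; exists (s ++ t, fun i => A i `&` B i).
    by move=> i; apply: open_nbhsI; [exact: As|exact: Bt].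
  move=> w /= ABw; split=> i ist; have [] := ABw i;
    by rewrite ?mem_cat ?ist ?orbT.
suff : boxes --> v by move=> /[apply] -[[s A] As AO]; exists s, A.
apply/cvg_sup => i N; rewrite nbhsE => -[_ [[C oC <-] Cv] CO].
exists ([:: i], fun j => if j == i then C else setT).
  by move=> j /=; case: eqP => [->//|_]; exact: open_nbhsT.
by move=> w /= /(_ i); rewrite mem_head eqxx => /(_ isT) Cw; exact: CO.
Qed.

Lemma continuous_ptws (X Y : topologicalType) (I : Type)
    (f : X -> {ptws I -> Y}) :
  (forall i, continuous (fun x => f x i)) -> continuous f.
Proof.
move=> cf x; apply/cvg_sup => i A [_ [[C oC <-] Cfx] /filterS]; apply.
by apply: cf; exact: open_nbhs_nbhs.
Qed.

(** * Borel sets and Borel maps *)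

Section borel_sets.
Context {T : topologicalType}.
Implicit Types P Q : T -> Prop.

Lemma eq_borel P Q : (forall x, P x <-> Q x) -> borel [set x | P x] ->
  borel [set x | Q x].
Proof. by move=> PQ; congr borel; apply/seteqP; split=> x /PQ. Qed.

Lemma open_borel (A : set T) : open A -> borel A.
Proof. exact: sub_sigma_algebra. Qed.

Lemma borel_not P : borel [set x | P x] -> borel [set x | ~ P x].
Proof. by rewrite -[X in _ -> _ X]setTD; exact: sigma_algebraCD. Qed.

Lemma borel_const (p : Prop) : borel [set x : T | p].
Proof.
have [hp|np] := pselect p.
  by apply: eq_borel (open_borel openT) => x; split.
by apply: eq_borel (open_borel open0) => x; split.
Qed.

Lemma borel_exists (I : countType) (P : I -> T -> Prop) :
  (forall i, borel [set x | P i x]) -> borel [set x | exists i, P i x].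
Proof.
move=> bP; pose B n : set T := if unpickle n is Some i then P i else set0.
apply: (@eq_borel (\bigcup_n B n)).
  move=> x; split=> [[n _]|[i Pix]].
    by rewrite /B; case: unpickle => // i; exists i.
  by exists (pickle i) => //; rewrite /B pickleK.
suff bB n : borel (B n) by exact: sigma_algebra_bigcup.
by rewrite /B; case: unpickle => [i|]; [exact: bP|exact: sigma_algebra0].
Qed.

Lemma borel_forall (I : countType) (P : I -> T -> Prop) :
  (forall i, borel [set x | P i x]) -> borel [set x | forall i, P i x].
Proof.
move=> bP; apply: (@eq_borel (fun x => ~ exists i, ~ P i x)) => [x|].
  split=> [nex i|allP [i]]; last exact.
  by apply: contrapT => nPi; apply: nex; exists i.
by apply: borel_not; apply: borel_exists => i; exact: borel_not.
Qed.

Lemma borel_or P Q : borel [set x | P x] -> borel [set x | Q x] ->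
  borel [set x | P x \/ Q x].
Proof.
move=> bP bQ.
apply: (@eq_borel (fun x => exists b : bool, if b then P x else Q x)).
  by move=> x; split=> [[[] ?]|[?|?]]; [left|right|exists true|exists false].
by apply: (@borel_exists bool (fun b x => if b then P x else Q x)) => -[].
Qed.

Lemma borel_and P Q : borel [set x | P x] -> borel [set x | Q x] ->
  borel [set x | P x /\ Q x].
Proof.
move=> bP bQ.
apply: (@eq_borel (fun x => forall b : bool, if b then P x else Q x)).
  move=> x; split=> [PQx|[Px Qx] []//].
  by split; [exact: (PQx true)|exact: (PQx false)].
by apply: (@borel_forall bool (fun b x => if b then P x else Q x)) => -[].
Qed.

Lemma borel_imply P Q : borel [set x | P x] -> borel [set x | Q x] ->
  borel [set x | P x -> Q x].
Proof.
move=> bP bQ; apply: (@eq_borel (fun x => ~ P x \/ Q x)) => [x|].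
  by rewrite implyE.
by apply: borel_or => //; exact: borel_not.
Qed.

End borel_sets.

Definition borel_map (X Y : topologicalType) (f : X -> Y) : Prop :=
  forall A, borel A -> borel (f @^-1` A).

Section borel_maps.
Context {X Y : topologicalType}.
Implicit Types f : X -> Y.

Lemma borel_map_open f : (forall A, open A -> borel (f @^-1` A)) -> borel_map f.
Proof.
move=> bf A bA.
have sigmaX : sigma_algebra setT (@borel X) by exact: smallest_sigma_algebra.
have sigmaY := sigma_algebra_image f sigmaX.
rewrite -[_ @^-1` _]setTI; apply: (bA _ (conj sigmaY _)) => B /bf.
by rewrite /image_set_system /= setTI.
Qed.

Lemma continuous_borel_map f : continuous f -> borel_map f.
Proof.
by move=> /continuousP cf; apply: borel_map_open => A /cf; exact: open_borel.
Qed.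

Lemma borel_map_comp (Z : topologicalType) (g : Y -> Z) f :
  borel_map g -> borel_map f -> borel_map (g \o f).
Proof. by move=> bg bf A /bg/bf. Qed.

Lemma borel_map_discrete (D : discreteTopologicalType) (g : X -> D)
    (Q : set D) :
  borel_map g -> borel [set x | Q (g x)].
Proof. by apply; apply: open_borel; exact: discrete_open. Qed.

End borel_maps.

Lemma borel_map_id (X : topologicalType) : borel_map (@id X).
Proof. by []. Qed.

Lemma borel_map_fst (X Y : topologicalType) : borel_map (@fst X Y).
Proof. by apply: continuous_borel_map; exact: continuous_fst. Qed.

Lemma borel_map_snd (X Y : topologicalType) : borel_map (@snd X Y).
Proof. by apply: continuous_borel_map; exact: continuous_snd. Qed.

Lemma borel_map_nat (X : topologicalType) (f : X -> nat) :
  (forall n, borel [set x | f x = n]) -> borel_map f.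
Proof.
move=> bf; apply: borel_map_open => A _.
apply: (@eq_borel _ (fun x => exists n, A n /\ f x = n)) => [x|].
  by split=> [[n [An ->]]|Ax] //; exists (f x).
by apply: borel_exists => n; apply: borel_and; [exact: borel_const|exact: bf].
Qed.

Lemma borel_map_nat_rel (X : topologicalType) (f g : X -> nat)
    (Q : nat -> nat -> Prop) :
  borel_map f -> borel_map g -> borel [set x | Q (f x) (g x)].
Proof.
move=> bf bg; apply: (@eq_borel _ (fun x => exists n, f x = n /\ Q n (g x))).
  by move=> x; split=> [[n [-> Qn]]|Qx] //; exists (f x).
apply: borel_exists => n; apply: borel_and.
  exact: (borel_map_discrete [set i | i = n]).
exact: (borel_map_discrete (Q n)).
Qed.

Section second_countable_codomains.
Context {X Y : topologicalType} (countY : @second_countable Y).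

Lemma borel_map_pair (Z : topologicalType) (f : X -> Y) (g : X -> Z) :
  @second_countable Z -> borel_map f -> borel_map g ->
  borel_map (fun x => (f x, g x)).
Proof.
move=> /second_countableP[C oC baseC] bf bg.
have /second_countableP[B oB baseB] := countY.
apply: borel_map_open => A oA.
apply: (@eq_borel _ (fun x => exists mn, B mn.1 `*` C mn.2 `<=` A /\
    (B mn.1 (f x) /\ C mn.2 (g x)))) => [x|].
  split=> [[mn [BCA BCx]]|Ax]; first exact: BCA.
  have : open_nbhs (f x, g x) A by [].
  move=> /open_nbhs_nbhs[[U W] /= [/baseB[m Bx BU] /baseC[n Cx CW]] UWA].
  by exists (m, n); split=> // -[y z] [/BU Uy /CW Wz]; exact: UWA.
apply: borel_exists => mn; apply: borel_and; first exact: borel_const.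
by apply: borel_and; [exact: bf (open_borel _)|exact: bg (open_borel _)].
Qed.

Lemma borel_map_ptws (I : countType) (f : I -> X -> Y) :
  (forall i, borel_map (f i)) ->
  @borel_map X {ptws I -> Y} (fun x i => f i x).
Proof.
have /second_countableP[B oB baseB] := countY.
move=> bf; apply: borel_map_open => A oA.
pose box (p : seq (I * nat)) : set {ptws I -> Y} :=
  [set w | {in p, forall ij, B ij.2 (w ij.1)}].
apply: (@eq_borel _ (fun x => exists p, box p `<=` A /\
    forall ij, ij \in p -> B ij.2 (f ij.1 x))) => [x|].
  split=> [[p [pA px]]|Ax]; first exact: pA.
  have : nbhs ((fun i => f i x) : {ptws I -> Y}) A by exact: open_nbhs_nbhs.
  move=> /nbhs_ptws[s [U [Ux UA]]].
  have /choice[n nP] : forall i, exists n, B n (f i x) /\ B n `<=` U i.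
    by move=> i; have /open_nbhs_nbhs/baseB[n] := Ux i; exists n.
  exists [seq (i, n i) | i <- s]; split=> [w sw|_ /mapP[i _ ->]].
    by apply: UA => i /(map_f (fun i => (i, n i)))/sw; exact: (nP i).2.
  exact: (nP i).1.
apply: borel_exists => p; apply: borel_and; first exact: borel_const.
apply: borel_forall => ij; apply: borel_imply; first exact: borel_const.
exact: bf (open_borel _).
Qed.

End second_countable_codomains.

(** * Analytic sets *)

Local Notation baire := {ptws nat -> nat}.

Definition agree (n : nat) (x y : nat -> nat) : Prop :=
  forall k, k < n -> x k = y k.

Lemma neq_digit (x y : nat -> nat) : x <> y <-> exists n, x n <> y n.
Proof.
split=> [xy|[n + xy]]; last by rewrite xy.
by apply/existsNP => same; apply: xy; exact/funext.
Qed.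

Lemma nbhs_baireP (x : baire) (A : set baire) :
  nbhs x A <-> exists n, forall y : baire, agree n x y -> A y.
Proof.
split=> [/nbhs_ptws[s [B [Bx BA]]]|[n nA]].
  exists (\max_(i <- s) i.+1) => y xy; apply: BA => i si.
  rewrite -xy; first by have [] := Bx i.
  exact: (@leq_bigmax_seq nat s xpredT succn).
have /filter_forall : forall k : 'I_n, nbhs x [set y : baire | y k = x k].
  move=> k.
  exact: (@proj_continuous nat (fun=> nat) k x _ (discrete_set1 _)).
by apply: filterS => y yx; apply: nA => k kn; rewrite (yx (Ordinal kn)).
Qed.

Lemma continuous_digit (n : nat) : continuous (fun x : baire => x n).
Proof. exact: (@proj_continuous nat (fun=> nat)). Qed.

Lemma borel_map_digit (n : nat) : borel_map (fun x : baire => x n).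
Proof. by apply: continuous_borel_map; exact: continuous_digit. Qed.

(* Reading a point of Baire space along [pickle] as a sequence of points. *)
Definition strand (k : nat) (z : baire) : baire := fun n => z (pickle (k, n)).

Definition interleave (z : nat -> baire) : baire :=
  fun m => if unpickle m is Some (k, n) then z k n else 0.

Lemma strand_interleave (z : nat -> baire) (k : nat) :
  strand k (interleave z) = z k.
Proof. by apply/funext => n; rewrite /strand /interleave pickleK. Qed.

Lemma continuous_strand (k : nat) : continuous (strand k).
Proof. by apply: continuous_ptws => n; exact: continuous_digit. Qed.

Lemma continuous_interleave (X : topologicalType) (f : nat -> X -> baire) :
  (forall k, continuous (f k)) -> continuous (fun x => interleave (f^~ x)).
Proof.
move=> cf; apply: continuous_ptws => m; rewrite /interleave.
case: unpickle => [[k n]|]; last exact: cst_continuous.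
exact: (continuous_funcomp (cf k) (@continuous_digit n)).
Qed.

Definition interleave2 (x y : baire) : baire :=
  interleave (fun k => if k is 0 then x else y).

Lemma strand0_interleave2 (x y : baire) : strand 0 (interleave2 x y) = x.
Proof. exact: strand_interleave. Qed.

Lemma strand1_interleave2 (x y : baire) : strand 1 (interleave2 x y) = y.
Proof. exact: strand_interleave. Qed.

Lemma continuous_interleave2 (X : topologicalType) (f g : X -> baire) :
  continuous f -> continuous g -> continuous (fun x => interleave2 (f x) (g x)).
Proof.
move=> cf cg; pose fg k x := if k is 0 then f x else g x.
by apply: (@continuous_interleave _ fg) => -[|k]; [exact: cf|exact: cg].
Qed.

Lemma closed_digit (X : topologicalType) (f : X -> baire) (n : nat)
    (Q : set nat) :
  continuous f -> closed [set x | Q (f x n)].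
Proof.
move=> cf; have /continuous_closedP cfn : continuous (fun x => f x n).
  exact: (continuous_funcomp cf (@continuous_digit n)).
by apply: cfn; exact: discrete_closed.
Qed.

Definition analytic (X : topologicalType) (A : set X) : Prop :=
  exists2 C : set (X * baire), closed C & forall x, A x <-> exists z, C (x, z).

Section analytic_sets.
Context {X : topologicalType}.
Implicit Types (A B : set X) (P Q : X -> Prop).

Lemma eq_analytic P Q : (forall x, P x <-> Q x) -> analytic [set x | P x] ->
  analytic [set x | Q x].
Proof. by move=> PQ; congr analytic; apply/seteqP; split=> x /PQ. Qed.

Lemma closed_analytic A : closed A -> analytic A.
Proof.
move=> cA; exists (fst @^-1` A) => [|x].
  by apply: preimage_closed cA => p _; exact: continuous_fst.
by split=> [Ax|[]//]; exists (fun=> 0).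
Qed.

Let continuous_strand_snd k : continuous (fun p : X * baire => strand k p.2).
Proof.
exact: (continuous_funcomp (@continuous_snd _ _) (@continuous_strand k)).
Qed.

Let continuous_pair_strand k :
  continuous (fun p : X * baire => (p.1, strand k p.2)).
Proof.
exact: continuous_pair (@continuous_fst _ _) (@continuous_strand_snd k).
Qed.

(* The first digit of the witness names the index. *)
Lemma analytic_exists (A : nat -> set X) : (forall k, analytic (A k)) ->
  analytic [set x | exists k, A k x].
Proof.
move=> /exists2_choice[C cC AC].
pose index (p : X * baire) := strand 0 p.2 0.
exists (\bigcap_k (index @^-1` [set~ k] `|`
                   (fun p => (p.1, strand 1 p.2)) @^-1` C k)).
  apply: closed_bigI => k _; apply: closedU.
    exact: (@closed_digit _ (fun p : X * baire => strand 0 p.2) 0 [set~ k]).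
  by apply: preimage_closed (cC k) => p _; exact: continuous_pair_strand.
move=> x; split=> [[k /AC[z Cz]]|[z Cz]].
  exists (interleave2 (fun=> k) z) => i _.
  rewrite /index /= strand0_interleave2 strand1_interleave2.
  by have [<-|/eqP ki] := eqVneq k i; [right|left].
exists (strand 0 z 0); apply/AC; exists (strand 1 z).
by have [/(_ erefl)|] := Cz (strand 0 z 0) I.
Qed.

Lemma analytic_forall (A : nat -> set X) : (forall k, analytic (A k)) ->
  analytic [set x | forall k, A k x].
Proof.
move=> /exists2_choice[C cC AC].
exists (\bigcap_k (fun p => (p.1, strand k p.2)) @^-1` C k).
  apply: closed_bigI => k _.
  by apply: preimage_closed (cC k) => p _; exact: continuous_pair_strand.
move=> x; split=> [Ax|[z Cz] k]; last first.
  by apply/AC; exists (strand k z); exact: Cz.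
have /choice[z Cz] : forall k, exists z, C k (x, z) by move=> k; exact/AC.
by exists (interleave z) => k _; rewrite /= strand_interleave.
Qed.

Lemma analytic_and P Q : analytic [set x | P x] -> analytic [set x | Q x] ->
  analytic [set x | P x /\ Q x].
Proof.
move=> aP aQ.
apply: (@eq_analytic (fun x => forall k, (if k is 0 then P else Q) x)).
  move=> x; split=> [PQx|[Px Qx] []//].
  by split; [exact: (PQx 0)|exact: (PQx 1)].
by apply: analytic_forall => -[].
Qed.

Lemma analytic_preimage (Y : topologicalType) (f : Y -> X) A :
  continuous f -> analytic A -> analytic (f @^-1` A).
Proof.
move=> cf [C cC AC]; exists ((fun p => (f p.1, p.2)) @^-1` C) => [|y].
  apply: preimage_closed cC => p _; apply: continuous_pair => {p}.
    exact: (continuous_funcomp (@continuous_fst _ _) cf).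
  exact: continuous_snd.
exact: AC.
Qed.

Lemma analytic_proj (A : set (X * baire)) : analytic A ->
  analytic [set x | exists y, A (x, y)].
Proof.
move=> [C cC AC].
exists ((fun p => ((p.1, strand 0 p.2), strand 1 p.2)) @^-1` C).
  by apply: preimage_closed cC => p _; exact: continuous_pair.
move=> x; split=> [[y /AC[z Cz]]|[z Cz]]; last first.
  by exists (strand 0 z); apply/AC; exists (strand 1 z).
exists (interleave2 y z).
by rewrite /= strand0_interleave2 strand1_interleave2.
Qed.

End analytic_sets.

Lemma open_analytic_baire (O : set baire) : open O -> analytic O.
Proof.
move=> oO.
pose core n : set baire := [set x | forall y : baire, agree n x y -> O y].
apply: (@eq_analytic _ (fun x => exists n, core n x)) => [x|].
  split=> [[n]|Ox]; first exact.
  by apply/nbhs_baireP; exact: open_nbhs_nbhs.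
apply: analytic_exists => n; apply: closed_analytic => x.
have near_x : nbhs x [set y : baire | agree n x y].
  by apply/nbhs_baireP; exists n.
move=> /(_ _ near_x)[y [core_y xy]] w xw; apply: core_y => k kn.
by rewrite -xy// xw.
Qed.

Lemma borel_analytic (X : topologicalType) (A : set X) :
  (forall O : set X, open O -> analytic O) -> borel A -> analytic A.
Proof.
move=> open_analytic bA.
pose bianalytic := [set B : set X | analytic B /\ analytic (~` B)].
suff sigma : sigma_algebra setT bianalytic.
  apply: (proj1 (bA _ (conj sigma _))) => O oO.
  split; first exact: open_analytic.
  by apply: closed_analytic; exact: open_closedC.
split.
- split; apply: closed_analytic; first exact: closed0.
  by rewrite setC0; exact: closedT.
- by move=> B [aB aCB]; rewrite setTD; split; rewrite ?setCK.
- move=> B aB; split.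
    apply: eq_analytic (analytic_exists (fun k => (aB k).1)) => x.
    by split=> [[k]|[k _]]; exists k.
  rewrite setC_bigcup.
  apply: eq_analytic (analytic_forall (fun k => (aB k).2)) => x.
  by split=> [nBx k _|nBx k]; exact: nBx.
Qed.

(* These are exactly the nonempty zero-dimensional Polish spaces. *)
Definition baire_retract (X : topologicalType) : Prop :=
  exists (code : X -> baire) (decode : baire -> X),
    [/\ continuous code, continuous decode & cancel code decode].

Lemma baire_retract_baire : baire_retract baire.
Proof. by exists id, id; split=> // x; exact: cvg_id. Qed.

Lemma baire_retract_prod (X Y : topologicalType) :
  baire_retract X -> baire_retract Y -> baire_retract (X * Y)%type.
Proof.
move=> [codeX [decodeX [cX dX XK]]] [codeY [decodeY [cY dY YK]]].
exists (fun p => interleave2 (codeX p.1) (codeY p.2)).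
exists (fun z => (decodeX (strand 0 z), decodeY (strand 1 z))); split.
- apply: continuous_interleave2.
    exact: (continuous_funcomp (@continuous_fst _ _) cX).
  exact: (continuous_funcomp (@continuous_snd _ _) cY).
- apply: continuous_pair.
    exact: (continuous_funcomp (@continuous_strand 0) dX).
  exact: (continuous_funcomp (@continuous_strand 1) dY).
- by move=> [x y]; rewrite strand0_interleave2 strand1_interleave2 XK YK.
Qed.

Lemma baire_hausdorff : hausdorff_space baire.
Proof. by apply: hausdorff_product => n; exact: discrete_hausdorff. Qed.

Lemma baire_retract_hausdorff (X : topologicalType) :
  baire_retract X -> hausdorff_space X.
Proof.
move=> [code [decode [cc _ codeK]]] x y clxy; apply: (can_inj codeK).
apply: baire_hausdorff => A B nA nB.
by have [z [Az Bz]] := clxy _ _ (cc x _ nA) (cc y _ nB); exists (code z).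
Qed.

Lemma baire_retract_borel_analytic (X : topologicalType) (A : set X) :
  baire_retract X -> borel A -> analytic A.
Proof.
move=> [code [decode [cc /continuousP cd codeK]]].
apply: borel_analytic => O oO.
apply: (@eq_analytic _ (fun x => O (decode (code x)))) => [x|].
  by rewrite codeK.
apply: (@analytic_preimage _ _ code (decode @^-1` O)) => //.
by apply: open_analytic_baire; exact: cd.
Qed.

(** * Separation of analytic sets *)

Lemma infinite_branch (V : Type) (Q : seq V -> Prop) :
  Q [::] -> (forall s, Q s -> exists v, Q (rcons s v)) ->
  exists sigma : nat -> V, forall l, Q (mkseq sigma l).
Proof.
move=> Q0 ext; have [v0 _] := ext _ Q0.
have /choice[next nextP] : forall s, exists v, Q s -> Q (rcons s v).
  by move=> s; have [/ext[v]|] := pselect (Q s); [exists v|exists v0].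
pose branch n := iter n (fun s => rcons s (next s)) [::].
have branchE l : mkseq (next \o branch) l = branch l.
  by elim: l => // l IH; rewrite mkseqS IH.
exists (next \o branch) => l; rewrite branchE.
by elim: l => //= l; exact: nextP.
Qed.

Definition borel_separated (X : topologicalType) (A : nat -> set X) : Prop :=
  exists B : nat -> set X, [/\ forall n, borel (B n), forall n, A n `<=` B n &
    forall x, exists n, ~ B n x].

Section borel_separated.
Context {X : topologicalType}.
Implicit Types (A : nat -> set X) (S : set X).

Lemma sub_borel_separated A A' : (forall n, A n `<=` A' n) ->
  borel_separated A' -> borel_separated A.
Proof.
move=> AA' [B [bB A'B capB]]; exists B; split=> // n.
exact: subset_trans (AA' n) (A'B n).
Qed.

Lemma borel_separated_split A k (P : nat -> set X) : A k `<=` \bigcup_i P i ->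
  (forall i, borel_separated (fun n => if n == k then P i else A n)) ->
  borel_separated A.
Proof.
move=> AkP /choice[B sepB].
exists (fun n => if n == k then [set x | exists i, B i n x]
                 else [set x | forall i, B i n x]); split=> [n|n x Ax|x].
- case: eqP => _; [apply: borel_exists|apply: borel_forall] => i;
    have [bB _ _] := sepB i; exact: bB.
- have [nk|nk] := eqVneq n k.
    rewrite nk in Ax; have [i _ Px] := AkP x Ax; exists i.
    by have [_ + _] := sepB i => /(_ n); rewrite nk eqxx; apply.
  by move=> i; have [_ + _] := sepB i => /(_ n); rewrite (negbTE nk); apply.
- have [[i Bx]|nBx] := pselect (exists i, B i k x); last first.
    by exists k; rewrite eqxx.
  have [_ _ /(_ x)[n nBx]] := sepB i; exists n; case: eqP nBx => [->//|_] nBx.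
  by move=> /(_ i).
Qed.

Lemma borel_separated_disjoint A k k' S : borel S ->
  A k `<=` S -> A k' `<=` ~` S -> borel_separated A.
Proof.
move=> bS AS AS'.
exists (fun n => [set x | (n = k -> S x) /\ (n = k' -> ~ S x)]).
split=> [n|n x Ax|x].
- have bnS : borel [set x | ~ S x] by exact: borel_not.
  by apply: borel_and; apply: borel_imply => //; exact: borel_const.
- by split=> nk; rewrite nk in Ax; [exact: AS|exact: AS'].
- have [Sx|nSx] := pselect (S x); first by exists k' => -[_ /(_ erefl)].
  by exists k => -[/(_ erefl)].
Qed.

End borel_separated.

(* The entry of [s] at a position coding [(k, j)] prescribes the digit [j] of
   the [k]-th point, so that a single branch determines infinitely many points.
*)
Definition cylinder (s : seq nat) (k : nat) : set baire :=
  [set z | forall m j : nat, m < size s -> unpickle m = Some (k, j) ->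
    z j = nth 0 s m].

Lemma cylinder_rcons s v k (z : baire) : cylinder s k z ->
  (forall j, unpickle (size s) = Some (k, j) -> z j = v) ->
  cylinder (rcons s v) k z.
Proof.
move=> zs zv m j; rewrite size_rcons ltnS leq_eqVlt nth_rcons.
move=> /orP[/eqP->|ms].
  by rewrite ltnn eqxx; exact: zv.
by rewrite ms; exact: zs.
Qed.

Lemma cylinder_sub_nbhs (sigma : nat -> nat) k (O : set baire) :
  nbhs (strand k sigma) O ->
  exists l0, forall l, l0 <= l -> cylinder (mkseq sigma l) k `<=` O.
Proof.
move=> /nbhs_baireP[n nO].
exists (\max_(j < n) (pickle (k, val j)).+1) => l /bigmax_leqP le_l z zl.
apply: nO => j jn; have kjl := le_l (Ordinal jn) isT.
by rewrite (zl (pickle (k, j)) j) ?pickleK ?size_mkseq// nth_mkseq.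
Qed.

Section novikov.
Context {X : topologicalType} (F : nat -> set baire) (f : nat -> baire -> X).

Let piece (s : seq nat) (k : nat) : set X := f k @` (F k `&` cylinder s k).

Let borel_separated_extend s :
  (forall v, borel_separated (piece (rcons s v))) -> borel_separated (piece s).
Proof.
have grow v k : (forall j : nat, unpickle (size s) <> Some (k, j)) ->
    piece s k `<=` piece (rcons s v) k.
  move=> nk _ [z [Fz zs] <-]; exists z => //; split=> //.
  by apply: cylinder_rcons => // j /nk.
move=> sep.
case codes: (unpickle (size s) : option (nat * nat)) => [[k j]|]; last first.
  by apply: sub_borel_separated (sep 0) => k; apply: grow => j; rewrite codes.
apply: (@borel_separated_split _ _ k (fun v => piece (rcons s v) k)).
  move=> _ [z [Fz zs] <-]; exists (z j) => //; exists z => //; split=> //.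
  by apply: cylinder_rcons => // i; rewrite codes => -[<-].
move=> v; apply: sub_borel_separated (sep v) => n.
by case: eqP => [->//|/nesym kn]; apply: grow => i; rewrite codes => -[/kn].
Qed.

Lemma borel_separated_images : hausdorff_space X ->
  (forall k, closed (F k)) -> (forall k, continuous (f k)) ->
  (forall x, exists k, ~ (f k @` F k) x) ->
  borel_separated (fun k => f k @` F k).
Proof.
move=> hausX cF cf disj; apply: contrapT => nsep.
have [|s ns|sigma inseparable] :=
    @infinite_branch _ (fun s => ~ borel_separated (piece s)).
- apply: contra_not nsep; apply: sub_borel_separated => k _ [z Fz <-].
  by exists z.
- apply: contrapT => nex; apply: ns; apply: borel_separated_extend => v.
  by apply: contrapT => ?; apply: nex; exists v.
pose z k := strand k sigma.
have Fz k : F k (z k).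
  apply: contrapT => nFz; have [|l0 F0] := @cylinder_sub_nbhs sigma k (~` F k).
    by apply: open_nbhs_nbhs; split=> //; exact: closed_openC.
  apply: (inseparable l0); apply: (@borel_separated_disjoint _ _ k k setT).
  + exact: borel_const.
  + by [].
  + by move=> x [y [Fy /(F0 _ (leqnn l0))]].
have [k /eqP neq] : exists k, f k (z k) <> f 0 (z 0).
  have [k nk] := disj (f 0 (z 0)); exists k => e.
  by apply: nk; exists (z k).
have := hausX; rewrite open_hausdorff => /(_ _ _ neq)[[A B] /=].
rewrite !inE => -[Az Bz] [oA oB AB0].
have [lA pieceA] := @cylinder_sub_nbhs sigma k _
  (cf k _ _ (open_nbhs_nbhs (conj oA Az))).
have [lB pieceB] := @cylinder_sub_nbhs sigma 0 _
  (cf 0 _ _ (open_nbhs_nbhs (conj oB Bz))).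
apply: (inseparable (maxn lA lB)); apply: (@borel_separated_disjoint _ _ k 0 A).
- exact: open_borel.
- by move=> _ [y [_ /(pieceA _ (leq_maxl _ _))] Ay <-].
- move=> _ [y [_ /(pieceB _ (leq_maxr _ _)) By] <-] Ay.
  suff : set0 (f 0 y) by [].
  by rewrite -AB0.
Qed.

End novikov.

Section separation.
Context {X : topologicalType} (retractX : baire_retract X).

Theorem novikov_separation (A : nat -> set X) : (forall n, analytic (A n)) ->
  (forall x, exists n, ~ A n x) -> borel_separated A.
Proof.
have [code [decode [_ cd codeK]]] := retractX.
move=> /exists2_choice[C cC AC] disjA.
have c0 := continuous_funcomp (@continuous_strand 0) cd.
pose F n : set baire := [set z | C n (decode (strand 0 z), strand 1 z)].
apply: (@sub_borel_separated _ _ (fun n => (decode \o strand 0) @` F n)).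
  move=> n x /AC[z Cz]; exists (interleave2 (code x) z).
    by rewrite /F /= strand0_interleave2 strand1_interleave2 codeK.
  by rewrite /= strand0_interleave2.
apply: borel_separated_images => //.
- exact: baire_retract_hausdorff.
- move=> n; apply: preimage_closed (cC n) => z _.
  by apply: continuous_pair => //; exact: continuous_strand.
- move=> x; have [n nAx] := disjA x; exists n => -[z Fz zx].
  by apply/nAx/AC; exists (strand 1 z); rewrite -zx.
Qed.

Corollary lusin_separation (A B : set X) : analytic A -> analytic B ->
  (forall x, A x -> ~ B x) -> exists S, [/\ borel S, A `<=` S & B `<=` ~` S].
Proof.
move=> aA aB disj; have [[]//|x|S [bS AS capS]] :=
    @novikov_separation (fun n => if n is 0 then A else B).
  by have [/disj|] := pselect (A x); [exists 1|exists 0].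
exists (S 0); split=> // [|x Bx]; first exact: (AS 0).
have [[//|n] nSx] := capS x.
by case: nSx; exact: (AS n.+1).
Qed.

Corollary analytic_trivIset_borel (A : nat -> set X) :
  (forall n, analytic (A n)) -> trivIset setT A ->
  exists D,
    [/\ forall n, borel (D n), forall n, A n `<=` D n & trivIset setT D].
Proof.
move=> aA trivA.
have /choice[S sepS] : forall ij : nat * nat, exists S, borel S /\
    (ij.1 <> ij.2 -> A ij.1 `<=` S /\ A ij.2 `<=` ~` S).
  move=> [i j] /=; have [|/eqP ij] := eqVneq i j.
    by exists set0; split=> //; exact: borel_const.
  have [|S [bS AiS AjS]] := lusin_separation (aA i) (aA j); last by exists S.
  by move=> x Aix Ajx; apply: ij; apply: trivA => //; exists x.
exists (fun i => [set x | forall j, i <> j -> S (i, j) x /\ ~ S (j, i) x]).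
split=> [i|i x Ax j ij|i j _ _ [x [Di Dj]]].
- apply: borel_forall => j; apply: borel_imply; first exact: borel_const.
  by apply: borel_and; [|apply: borel_not]; exact: (sepS _).1.
- have [/(_ x Ax) Sij _] := (sepS (i, j)).2 ij.
  by have [_ /(_ x Ax)] := (sepS (j, i)).2 (nesym ij).
- by apply: contrapT => ij; have [+ _] := Di j ij; have [_] := Dj i (nesym ij).
Qed.

End separation.

(** * Analytic relations with finite sections *)

Definition borel_covered (X Y : topologicalType) (E : X -> Y -> Prop) : Prop :=
  exists (I : countType) (F : I -> X -> Y), (forall i, borel_map (F i)) /\
    forall x y, E x y -> exists i, y = F i x.

Lemma borel_covered_exists (X Y : topologicalType) (J : countType)
    (E : J -> X -> Y -> Prop) :
  (forall j, borel_covered (E j)) ->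
  borel_covered (fun x y => exists j, E j x y).
Proof.
move=> covE.
have /choice[F coverF] : forall j, exists F : {I : countType & I -> X -> Y},
    (forall i, borel_map (tagged F i)) /\
    forall x y, E j x y -> exists i, y = tagged F i x.
  by move=> j; have [I [F FP]] := covE j; exists (existT _ I F).
exists {j : J & tag (F j)}, (fun i => tagged (F (tag i)) (tagged i)); split.
  by move=> i; exact: (coverF _).1.
move=> x y [j /((coverF j).2)[i ->]].
by exists (Tagged (fun j => tag (F j)) i).
Qed.

Lemma sub_borel_covered (X Y : topologicalType) (E E' : X -> Y -> Prop) :
  (forall x y, E x y -> E' x y) -> borel_covered E' -> borel_covered E.
Proof.
by move=> EE' [I [F [bF coverE']]]; exists I, F; split=> // x y /EE'/coverE'.
Qed.

Lemma borel_map_xget (X : topologicalType) (D : nat -> set X) :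
  (forall n, borel (D n)) -> trivIset setT D ->
  borel_map (fun x => xget 0 [set n | D n x]).
Proof.
move=> bD trivD; apply: borel_map_nat => n.
apply: (@eq_borel _ (fun x => D n x \/ n = 0 /\ forall m, ~ D m x)) => [x|].
  case: xgetP => [m _ /= Dm|nD].
    split=> [[Dn|[_ /(_ m)]//]|<-]; last by left.
    by apply: trivD => //; exists x.
  split=> [[/nD//|[->//]]|<-]; right.
  by split=> // m; exact: nD.
apply: borel_or; first exact: bD.
apply: borel_and; first exact: borel_const.
by apply: borel_forall => m; exact: borel_not (bD m).
Qed.

Lemma finite_set_isolated (S : set baire) (y : baire) : finite_set S ->
  exists n, forall y', S y' -> agree n y y' -> y' = y.
Proof.
move=> finS; have : nbhs y (~` (S `\ y)).
  apply: open_nbhs_nbhs; split; last by move=> -[_]; exact.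
  have /accessible_finite_set_closed := hausdorff_accessible baire_hausdorff.
  move=> closed_finite; apply: closed_openC; apply: closed_finite.
  exact: finite_setD.
move=> /nbhs_baireP[n nS]; exists n => y' Sy' yy'.
by apply: contrapT => ne; exact: (nS y' yy').
Qed.

Lemma analytic_digits (X : topologicalType) (f g : X -> baire) n
    (Q : nat -> nat -> Prop) :
  continuous f -> continuous g -> analytic [set x | Q (f x n) (g x n)].
Proof.
move=> cf cg.
apply: (@eq_analytic _ (fun x => exists i, f x n = i /\ Q i (g x n))).
  by move=> x; split=> [[i [-> Qi]]|Qx] //; exists (f x n).
apply: analytic_exists => i; apply: closed_analytic; apply: closedI.
  exact: (@closed_digit _ f n [set j | j = i]).
exact: (@closed_digit _ g n (Q i)).
Qed.

Section finite_sections.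
Context {X : topologicalType} (retractX : baire_retract X).
Implicit Types A : set (X * baire).

Lemma functional_analytic_borel A : analytic A ->
  (forall x y y', A (x, y) -> A (x, y') -> y = y') ->
  exists2 f : X -> baire, borel_map f & forall x y, A (x, y) -> y = f x.
Proof.
move=> aA funA.
pose value n i : set X := [set x | exists y : baire, A (x, y) /\ y n = i].
have /choice[D sepD] : forall n, exists D, [/\ forall i, borel (D i),
    forall i, value n i `<=` D i & trivIset setT D].
  move=> n; apply: analytic_trivIset_borel => // [i|i j _ _].
    apply: (@analytic_proj _ (A `&` [set p | p.2 n = i])).
    apply: analytic_and => //; apply: closed_analytic.
    exact: (@closed_digit _ snd n [set j | j = i] (@continuous_snd _ _)).
  move=> [x [[y [Axy <-]] [y' [Axy' <-]]]].
  by rewrite (funA _ _ _ Axy Axy').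
exists (fun x n => xget 0 [set i | D n i x]).
  apply: borel_map_ptws => [|n]; first exact: second_countable_nat.
  by apply: borel_map_xget; have [] := sepD n.
move=> x y Axy; apply/funext => n; have [_ valueD trivD] := sepD n.
have Dy : D n (y n) x by apply: valueD; exists y.
by apply/esym/xget_unique => // i Di; apply: trivD => //; exists x.
Qed.

Let crowded A n : set (X * baire) := [set p | A p /\
  exists y', A (p.1, y') /\ agree n p.2 y' /\ p.2 <> y'].

Let analytic_crowded A n : analytic A -> analytic (crowded A n).
Proof.
move=> aA; apply: analytic_and => //.
pose x (q : (X * baire) * baire) := q.1.1.
pose y (q : (X * baire) * baire) := q.1.2.
have cx : continuous x.
  exact: (continuous_funcomp (@continuous_fst _ _) (@continuous_fst _ _)).
have cy : continuous y.
  exact: (continuous_funcomp (@continuous_fst _ _) (@continuous_snd _ _)).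
have analytic_y_snd i (Q : nat -> nat -> Prop) :
    analytic [set q | Q (y q i) (q.2 i)].
  by apply: analytic_digits => //; exact: continuous_snd.
apply: (@analytic_proj _ [set q | A (x q, q.2) /\ agree n (y q) q.2 /\
  y q <> q.2]).
apply: analytic_and.
  apply: (@analytic_preimage _ _ (fun q => (x q, q.2))) => //.
  by apply: continuous_pair => //; exact: continuous_snd.
apply: analytic_and.
  apply: analytic_forall => i.
  exact: (analytic_y_snd i (fun a b => i < n -> a = b)).
apply: eq_analytic (fun q => iff_sym (neq_digit (y q) q.2)) _.
by apply: analytic_exists => i; exact: (analytic_y_snd i (fun a b => a <> b)).
Qed.

Theorem finite_sections_borel_covered A : analytic A ->
  (forall x, finite_set [set y | A (x, y)]) ->
  borel_covered (fun x y => A (x, y)).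
Proof.
move=> aA finA.
have retractXB := baire_retract_prod retractX baire_retract_baire.
have [n|[x y]|B [bB crowdedB capB]] :=
    novikov_separation retractXB (A := crowded A).
- exact: analytic_crowded.
- have [n isolated] := finite_set_isolated y (finA x).
  by exists n => -[_ [y' [Ay' [/(isolated _ Ay')->]]]].
pose part (ns : nat * seq nat) : set (X * baire) := [set p | A p /\
  (~ B ns.1 p /\ agree ns.1 p.2 (nth 0 ns.2))].
apply: (@sub_borel_covered _ _ _ (fun x y => exists ns, part ns (x, y))).
  move=> x y Axy; have [n nB] := capB (x, y); exists (n, mkseq y n).
  by split=> //; split=> // i ilt; rewrite nth_mkseq.
apply: borel_covered_exists => -[n s].
have [||f bf partf] := @functional_analytic_borel (part (n, s)).
- apply: analytic_and => //; apply: analytic_and.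
    by apply: baire_retract_borel_analytic => //; exact: borel_not (bB n).
  apply: analytic_forall => i; apply: closed_analytic.
  apply: (@closed_digit _ snd i (fun a => i < n -> a = nth 0 s i)).
  exact: continuous_snd.
- move=> x y y' [Ay [nBy ys]] [Ay' [_ y's]]; apply: contrapT => yy'.
  apply: nBy; apply: crowdedB; split=> //; exists y'; split=> //; split=> //.
  by move=> i ilt; rewrite ys//; apply/esym/y's.
by exists unit, (fun=> f); split=> // x y /partf ->; exists tt.
Qed.

End finite_sections.

(** * Polish spaces *)

Local Arguments harmonic : simpl never.

Section metric.
Context {R : realType} {T : topologicalType} (d : T -> T -> R).
Hypotheses (d_eq0 : forall x y, d x y = 0%R <-> x = y)
  (dC : forall x y, d x y = d y x)
  (d_triangle : forall x y z, (d x z <= d x y + d y z)%R).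
Hypothesis openP : forall A : set T, open A <->
  forall x, A x -> exists2 e : R, (0 < e)%R & forall y, (d x y < e)%R -> A y.

Let dxx x : d x x = 0%R. Proof. exact/d_eq0. Qed.

Let d_ge0 x y : (0 <= d x y)%R.
Proof. by have := d_triangle x y x; rewrite dxx (dC y x); lra. Qed.

Let harmonic_lt (e : R) : (0 < e)%R -> exists n, (harmonic n < e)%R.
Proof. by move=> /ltr_add_invr[n]; rewrite add0r; exists n. Qed.

Let harmonic_le m n : m <= n -> (harmonic n <= harmonic m :> R)%R.
Proof. by move=> mn; rewrite lef_pV2 ?posrE ?ltr0n// ler_nat. Qed.

Lemma open_metric_ball x e : open [set y | (d x y < e)%R].
Proof.
apply/openP => y /= xy; exists (e - d x y)%R; first by lra.
by move=> z yz; have := d_triangle x y z; lra.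
Qed.

Lemma metric_separable_second_countable (D : set T) : countable D -> dense D ->
  @second_countable T.
Proof.
move=> countD denseD.
pose ball (xn : T * nat) := [set y | (d xn.1 y < harmonic xn.2)%R].
exists (ball @` (D `*` setT)).
  exact: sub_countable (card_image_le _ _) (countableX countD (countableP _)).
split=> [_ [[x n] _ <-]|x A]; first exact: open_metric_ball.
rewrite nbhsE => -[U [/openP oU /oU[e e0 eU]] UA].
have [n ne] := @harmonic_lt (e / 2)%R ltac:(by lra).
have [|y [/= xy Dy]] := denseD _ _ (open_metric_ball x (harmonic n)).
  by exists x; rewrite /= dxx harmonic_gt0.
exists (ball (y, n)); first by split; [exists (y, n)|rewrite /ball /= dC].
by move=> z; rewrite /ball /= => yz; apply/UA/eU; have := d_triangle x y z; lra.
Qed.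

Section retract.
Context (q : nat -> T).
Hypothesis dense_q : forall x (e : R), (0 < e)%R -> exists j, (d x (q j) < e)%R.
Hypothesis complete : forall u : nat -> T,
  (forall e : R, (0 < e)%R -> exists N, forall m n, N <= m -> N <= n ->
    (d (u m) (u n) < e)%R) ->
  exists l, forall e : R, (0 < e)%R -> exists N, forall n, N <= n ->
    (d (u n) l < e)%R.

Let approximates (b : baire) (x : T) : Prop :=
  forall n, (d x (q (b n)) <= harmonic n)%R.

Let coherent (b : baire) : Prop :=
  forall m n, (d (q (b m)) (q (b n)) <= harmonic m + harmonic n)%R.

Let approximates_inj b x y : approximates b x -> approximates b y -> x = y.
Proof.
move=> bx yx; apply/d_eq0/eqP; rewrite eq_le d_ge0 andbT leNgt.
apply/negP => xy; have [n ne] := @harmonic_lt (d x y / 2)%R ltac:(by lra).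
have := bx n; have := yx n; have := d_triangle x (q (b n)) y.
by rewrite (dC (q (b n)) y); lra.
Qed.

Let approximates_coherent b x : approximates b x -> coherent b.
Proof.
move=> bx m n; have := d_triangle (q (b m)) x (q (b n)).
by have := bx m; have := bx n; rewrite (dC _ x); lra.
Qed.

Let coherent_approximates b : coherent b -> exists x, approximates b x.
Proof.
move=> cohb; have [e e0|x xP] := @complete (fun n => q (b n)).
  have [N Ne] := @harmonic_lt (e / 2)%R ltac:(by lra).
  exists N => m n /harmonic_le Nm /harmonic_le Nn.
  by have := cohb m n; lra.
exists x => n; apply/ler_addgt0Pr => e e0.
have [N xN] := xP (e / 2)%R ltac:(by lra).
have [M Me] := @harmonic_lt (e / 2)%R ltac:(by lra).
have := xN _ (leq_maxl N M); have := harmonic_le (leq_maxr N M).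
have := cohb (maxn N M) n; have := d_triangle x (q (b (maxn N M))) (q (b n)).
by rewrite (dC x (q (b (maxn N M)))); lra.
Qed.

Let approximates_open b x (A : set T) : open A -> approximates b x ->
  A x <-> exists n, forall y, (d y (q (b n)) <= harmonic n)%R -> A y.
Proof.
move=> /openP oA bx; split=> [/oA[e e0 eA]|[n nA]]; last exact: nA.
have [n ne] := @harmonic_lt (e / 2)%R ltac:(by lra).
exists n => y yq; apply: eA.
have := bx n; have := d_triangle x (q (b n)) y.
by rewrite (dC (q (b n)) y); lra.
Qed.

Let borel_digits m n (Q : nat -> nat -> Prop) :
  borel [set b : baire | Q (b m) (b n)].
Proof. by apply: borel_map_nat_rel; exact: borel_map_digit. Qed.

Let exists_decode : T -> exists2 decode : baire -> T,
  borel_map decode & forall b x, approximates b x -> decode b = x.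
Proof.
move=> x0; have /choice[decode decodeP] : forall b, exists x,
    (coherent b -> approximates b x) /\ (~ coherent b -> x = x0).
  move=> b; have [cohb|ncohb] := pselect (coherent b).
    by have [x bx] := coherent_approximates cohb; exists x.
  by exists x0.
exists decode => [|b x bx]; last first.
  exact: (approximates_inj ((decodeP b).1 (approximates_coherent bx)) bx).
apply: borel_map_open => A oA.
pose inside n i := forall y, (d y (q i) <= harmonic n)%R -> A y.
apply: (@eq_borel _ (fun b => coherent b /\ (exists n, inside n (b n)) \/
    ~ coherent b /\ A x0)) => [b|].
  have [cohb|ncohb] := pselect (coherent b); last first.
    by rewrite /= (decodeP b).2//; split=> [[[]|[]]|] //; right.
  have insideP := approximates_open oA ((decodeP b).1 cohb).
  by split=> [[[_ /insideP]|[]]|/insideP] //; left.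
have borel_coherent : borel [set b | coherent b].
  apply: borel_forall => m; apply: borel_forall => n.
  pose close i j := (d (q i) (q j) <= harmonic m + harmonic n)%R.
  exact: (borel_digits m n close).
apply: borel_or; apply: borel_and => //.
- apply: borel_exists => n.
  exact: (borel_digits n n (fun i _ => inside n i)).
- exact: borel_not.
- exact: borel_const.
Qed.

Let exists_code : exists2 code : T -> baire,
  borel_map code & forall x, approximates (code x) x.
Proof.
pose near x n j := (d x (q j) < harmonic n)%R.
have /choice[code codeP] : forall x, exists b : baire, forall n,
    near x n (b n) /\ forall j, near x n j -> b n <= j.
  move=> x; suff /choice[b bP] : forall n, exists j,
    near x n j /\ forall i, near x n i -> j <= i by exists b.
  move=> n; have [j nearj minj] := ex_minnP (dense_q x (@harmonic_gt0 R n)).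
  by exists j.
exists code => [|x n]; last by apply: ltW; have [] := codeP x n.
have borel_near n j : borel [set x | near x n j].
  apply: eq_borel (open_borel (open_metric_ball (q j) (harmonic n))) => x.
  by rewrite /near dC.
apply: (borel_map_ptws second_countable_nat) => n; apply: borel_map_nat => j.
apply: (@eq_borel _ (fun x =>
    near x n j /\ forall i, i < j -> ~ near x n i)) => [x|].
  have [near_code min_code] := codeP x n; split=> [[nearj minj]|<-].
    apply/eqP; rewrite eqn_leq min_code//= leqNgt; apply/negP => /minj.
    exact.
  by split=> // i; rewrite ltnNge => /negP lt_i /min_code.
apply: borel_and => //; apply: borel_forall => i.
by apply: borel_imply; [exact: borel_const|exact: borel_not].
Qed.

Lemma complete_metric_borel_retract : T -> exists code decode,
  [/\ @borel_map T baire code, borel_map decode & cancel code decode].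
Proof.
move=> /exists_decode[decode bd decodeE]; have [code bc codeP] := exists_code.
by exists code, decode; split=> // x; exact: decodeE.
Qed.

End retract.

End metric.

Lemma polish_second_countable (R : realType) (T : topologicalType) :
  polish R T -> @second_countable T.
Proof.
by move=> [[D countD denseD] [d [[d0 dC dT] openE _]]];
  exact: (metric_separable_second_countable d0 dC dT openE countD denseD).
Qed.

Lemma polish_borel_retract (R : realType) (T : topologicalType) :
  polish R T -> T -> exists code decode,
    [/\ @borel_map T baire code, borel_map decode & cancel code decode].
Proof.
move=> [[D countD denseD] [d [[d0 dC dT] openE complete]]] x0.
have [D0|[q]] := pfcard_geP countD.
  have [|x []] := denseD setT _ openT; first by exists x0.
  by rewrite D0.
apply: (complete_metric_borel_retract d0 dC dT openE (q := q)) => // x e e0.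
have [|y [/= xy Dy]] := denseD _ _ (open_metric_ball dT openE x e).
  by exists x; rewrite /= (proj2 (d0 x x)).
have [j _ qj] : range q y by exact: surj.
by exists j; rewrite qj.
Qed.

Definition borel_rel (X Y : topologicalType) (E : X -> Y -> Prop) : Prop :=
  borel [set p | E p.1 p.2].

Lemma borel_map_rel (X T : topologicalType) (f g : X -> T)
    (E : T -> T -> Prop) :
  @second_countable T -> borel_map f -> borel_map g -> borel_rel E ->
  borel [set x | E (f x) (g x)].
Proof. by move=> countT bf bg; exact: (borel_map_pair countT countT bf bg). Qed.

Definition lex_lt (x y : baire) : Prop := exists n, agree n x y /\ x n < y n.

Lemma lex_lt_linear : linear_order lex_lt.
Proof.
split=> [x [n [_]]|x y z [m [xy xy_m]] [n [yz yz_n]]|x y].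
- by rewrite ltnn.
- exists (minn m n); split=> [k|].
    by rewrite leq_min => /andP[km kn]; rewrite xy// yz.
  case: (ltngtP m n) => [mn|nm|mn]; first by rewrite -yz.
    by rewrite xy.
  by rewrite mn in xy_m *; exact: ltn_trans yz_n.
- have [->|/neq_digit[n0 neq]] := pselect (x = y); first by constructor 2.
  have ex_diff : exists n, x n != y n by exists n0; exact/eqP.
  have [n xy_n min_n] := ex_minnP ex_diff.
  have xy : agree n x y.
    by move=> k kn; apply/eqP; apply: contraTT kn => /min_n; rewrite -leqNgt.
  case: (ltngtP (x n) (y n)) xy_n => // lt_n _.
    by constructor 1; exists n.
  by constructor 3; exists n; split=> // k kn; rewrite xy.
Qed.

Lemma linear_order_preimage (V W : Type) (f : V -> W) (lt : W -> W -> Prop) :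
  injective f -> linear_order lt -> linear_order (fun x y => lt (f x) (f y)).
Proof.
move=> injf [irr tr total]; split=> [x|x y z|x y]; [exact: irr|exact: tr|].
by case: (total (f x) (f y)) => [|/injf|];
  [constructor 1|constructor 2|constructor 3].
Qed.

Lemma borel_lex_lt (X : topologicalType) (f g : X -> baire) :
  borel_map f -> borel_map g -> borel [set x | lex_lt (f x) (g x)].
Proof.
move=> bf bg.
have borel_digits n (Q : nat -> nat -> Prop) :
    borel [set x | Q (f x n) (g x n)].
  exact: borel_map_nat_rel (borel_map_comp (@borel_map_digit n) bf)
    (borel_map_comp (@borel_map_digit n) bg).
apply: borel_exists => n; apply: borel_and.
  apply: borel_forall => k; apply: borel_imply; first exact: borel_const.
  exact: (borel_digits k eq).
exact: (borel_digits n (fun i j => i < j)).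
Qed.

Lemma polish_borel_linear_order (R : realType) (T : topologicalType) :
  polish R T -> exists2 lt : T -> T -> Prop, linear_order lt & borel_rel lt.
Proof.
move=> polT; have [[x0 _]|noT] := pselect (exists x : T, True); last first.
  exists (fun _ _ => False); last exact: borel_const.
  by split=> // x; case: noT; exists x.
have [code [decode [bc _ codeK]]] := polish_borel_retract polT x0.
exists (fun x y => lex_lt (code x) (code y)).
  exact: linear_order_preimage (can_inj codeK) lex_lt_linear.
apply: borel_lex_lt.
  exact: (borel_map_comp bc (@borel_map_fst T T)).
exact: (borel_map_comp bc (@borel_map_snd T T)).
Qed.

Theorem polish_finite_sections_covered (R : realType) (T : topologicalType)
    (E : T -> T -> Prop) : polish R T -> borel_rel E ->
  (forall x, finite_set [set y | E x y]) -> borel_covered E.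
Proof.
move=> polT bE finE.
have [[x0 _]|noT] := pselect (exists x : T, True); last first.
  exists unit, (fun=> id); split=> [_|x]; first exact: borel_map_id.
  by case: noT; exists x.
have [code [decode [bc bd codeK]]] := polish_borel_retract polT x0.
have countT := polish_second_countable polT.
have bd1 := borel_map_comp bd (@borel_map_fst baire baire).
have bd2 := borel_map_comp bd (@borel_map_snd baire baire).
pose A : set (baire * baire) := [set p | E (decode p.1) (decode p.2) /\
  p.2 = code (decode p.2)].
have [||I [F [bF coverA]]] :=
    @finite_sections_borel_covered _ baire_retract_baire A.
- apply: baire_retract_borel_analytic.
    exact: baire_retract_prod baire_retract_baire baire_retract_baire.
  apply: borel_and; first exact: borel_map_rel countT bd1 bd2 bE.
  apply: (@eq_borel _ (fun p : baire * baire =>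
      forall n, p.2 n = code (decode p.2) n)) => [p|].
    by split=> [/= same|/= {1}->//]; exact/funext.
  apply: borel_forall => n; apply: (borel_map_nat_rel eq).
    exact: borel_map_comp (@borel_map_digit n) (@borel_map_snd _ _).
  exact: borel_map_comp (@borel_map_digit n) (borel_map_comp bc bd2).
- move=> a; apply: sub_finite_set (finite_image code (finE (decode a))).
  by move=> b [/= Eab b_code]; exists (decode b).
exists I, (fun i => decode \o F i \o code); split=> [i|x y Exy].
  exact: borel_map_comp (borel_map_comp bd (bF i)) bc.
have [|i yi] := coverA (code x) (code y); first by rewrite /A /= !codeK.
by exists i; rewrite /= -yi codeK.
Qed.

(** * Locally countable Borel relations *)

Definition rel_comp (V : Type) (E E' : V -> V -> Prop) (x y : V) : Prop :=
  exists2 z, E x z & E' z y.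

Definition walk_le (V : Type) (E : V -> V -> Prop) (n : nat) (x y : V) : Prop :=
  exists m, m <= n /\ walk E m x y.

Lemma le_fin_path_metric (V : Type) (E : V -> V -> Prop) n x y :
  le_fin (path_metric E x y) n <-> walk_le E n x y.
Proof.
by split=> [/least_leP[m mn w]|[m [mn w]]];
  [exists m|apply/least_leP; exists m].
Qed.

(* On a Polish space these are exactly the Borel relations with countable
   sections, by the Lusin-Novikov theorem. *)
Definition locally_countable (T : topologicalType) (E : T -> T -> Prop) :
    Prop :=
  borel_rel E /\ borel_covered E.

Section locally_countable.
Context {T : topologicalType} (countT : @second_countable T).
Implicit Types E : T -> T -> Prop.

Lemma borel_rel_fst (A : set T) : borel A -> borel_rel (fun x _ : T => A x).
Proof. exact: borel_map_fst. Qed.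

Lemma borel_rel_snd (A : set T) : borel A -> borel_rel (fun _ y : T => A y).
Proof. exact: borel_map_snd. Qed.

Lemma eq_locally_countable E E' : (forall x y, E x y <-> E' x y) ->
  locally_countable E -> locally_countable E'.
Proof.
move=> EE' [bE covE]; split; first by apply: eq_borel bE => -[x y]; exact: EE'.
by apply: sub_borel_covered covE => x y /EE'.
Qed.

Lemma locally_countable_and E E' : borel_rel E -> locally_countable E' ->
  locally_countable (fun x y => E x y /\ E' x y).
Proof.
move=> bE [bE' covE']; split; first exact: borel_and.
by apply: sub_borel_covered covE' => x y [].
Qed.

Lemma locally_countable_exists (I : countType) (E : I -> T -> T -> Prop) :
  (forall i, locally_countable (E i)) ->
  locally_countable (fun x y => exists i, E i x y).
Proof.
move=> lcE; split; first by apply: borel_exists => i; exact: (lcE i).1.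
by apply: borel_covered_exists => i; exact: (lcE i).2.
Qed.

Lemma locally_countable_comp E E' :
  locally_countable E -> locally_countable E' ->
  locally_countable (rel_comp E E').
Proof.
move=> [bE [I [F [bF covF]]]] [bE' [J [H [bH covH]]]]; split.
  apply: (@eq_borel _ (fun p =>
      exists i, E p.1 (F i p.1) /\ E' (F i p.1) p.2)) => [p|].
    split=> [[i [EF E'F]]|[z Ez E'z]]; first by exists (F i p.1).
    by have [i zF] := covF _ _ Ez; exists i; rewrite -zF.
  have bF_fst i := borel_map_comp (bF i) (@borel_map_fst T T).
  apply: borel_exists => i; apply: borel_and.
    exact: borel_map_rel countT (@borel_map_fst T T) (bF_fst i) bE.
  exact: borel_map_rel countT (bF_fst i) (@borel_map_snd T T) bE'.
exists (I * J)%type, (fun ij => H ij.2 \o F ij.1); split.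
  by move=> ij; exact: borel_map_comp.
by move=> x y [z /covF[i ->] /covH[j ->]]; exists (i, j).
Qed.

Hypothesis borel_eq : borel_rel (@eq T).

Lemma locally_countable_eq : locally_countable (@eq T).
Proof.
split=> //; exists unit, (fun=> id).
by split=> [_|x y ->]; [exact: borel_map_id|exists tt].
Qed.

Lemma locally_countable_walk E n :
  locally_countable E -> locally_countable (walk E n).
Proof.
move=> lcE; elim: n => [|n IH]; first exact: locally_countable_eq.
exact: locally_countable_comp.
Qed.

Lemma locally_countable_walk_le E n :
  locally_countable E -> locally_countable (walk_le E n).
Proof.
move=> lcE; apply: locally_countable_exists => m.
by apply: locally_countable_and;
  [exact: borel_const|exact: locally_countable_walk].
Qed.

End locally_countable.

(** * The cell graph seen from the vertices *)

Section cells.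
Context {L : language} {V : Type} (G : sgraph L V) {s : nat} (r : nat)
  (U : 'I_s.+1 -> set V) (witU : asi_witness G r U).
Local Notation cell := (cell_of G r U).

Definition cell_adj (x y : V) : Prop :=
  ~ cell x y /\ rel_comp cell (rel_comp (walk_le (adj G) r) cell) x y.

Lemma eq_cell_of x y : cell x = cell y <-> cell x y.
Proof.
split=> [->|xy]; first exact: cell_of_self.
exact: (cells_memE witU (cells_cell_of witU x) xy).
Qed.

Lemma cell_of_sym x y : cell x y -> cell y x.
Proof. by move=> /eq_cell_of xy; apply/eq_cell_of. Qed.

Lemma cell_graph_cell_of x y :
  cell_graph G r U (cell x) (cell y) <-> cell_adj x y.
Proof.
split=> [[_ _ neq /least_leP[m mr [x' [y' [xx' yy' w]]]]]|].
  split; first by move/eq_cell_of.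
  exists x' => //; exists y'; last exact: cell_of_sym.
  by exists m.
move=> [nxy [x' xx' [y' [m [mr w]] y'y]]]; split; [exact: cells_cell_of|
  exact: cells_cell_of|by move/eq_cell_of|].
apply/least_leP; exists m => //; exists x', y'; split=> //.
exact: cell_of_sym.
Qed.

Lemma walk_cell_graph_cell_of m x y :
  walk (cell_graph G r U) m (cell x) (cell y) <->
  rel_comp (walk cell_adj m) cell x y.
Proof.
elim: m x => [|m IH] x /=.
  by split=> [/eq_cell_of xy|[_ <- /eq_cell_of//]]; exists x.
split=> [[D xD Dy]|[y' [z xz zy'] y'y]]; last first.
  by exists (cell z); [exact/cell_graph_cell_of|apply/IH; exists y'].
have [_ [i [z [Uiz Dz]]] _ _] := xD.
rewrite {}Dz -(cell_ofE witU Uiz) in xD Dy.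
have [y' zy' y'y] := (IH z).1 Dy.
by exists y' => //; exists z => //; exact/cell_graph_cell_of.
Qed.

Lemma cell_nbhd_cell_of n x y :
  cell_nbhd G r U n (cell x) y <-> rel_comp (walk_le cell_adj n) cell x y.
Proof.
split=> [[D [cD /le_fin_path_metric[m [mn w]]] Dy]|[y' [m [mn w]] y'y]].
  rewrite (cells_memE witU cD Dy) in w.
  have [y' w' y'y] := (walk_cell_graph_cell_of _ _ _).1 w.
  by exists y' => //; exists m.
exists (cell y); last exact: cell_of_self.
split; first exact: cells_cell_of.
apply/le_fin_path_metric; exists m; split=> //.
by apply/walk_cell_graph_cell_of; exists y'.
Qed.

End cells.

Section locally_countable_cells.
Context {L : language} {T : topologicalType} (G : sgraph L T)
  {s : nat} (r : nat) (U : 'I_s.+1 -> set T) (witU : asi_witness G r U).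
Hypotheses (countT : @second_countable T) (borel_eq : borel_rel (@eq T))
  (borelU : forall i, borel (U i)) (adj_lc : locally_countable (adj G)).

Lemma locally_countable_piece_graph i : locally_countable (piece_graph G r U i).
Proof.
apply: (@eq_locally_countable _ (fun x y => U i x /\ (U i y /\ (x <> y /\
    walk_le (adj G) r x y)))) => [x y|].
  split=> [[Ux [Uy [xy w]]]|[Ux Uy [xy w]]].
    by split=> //; split=> //; exact/le_fin_path_metric.
  by do 3 split=> //; exact/le_fin_path_metric.
apply: locally_countable_and; first exact: borel_rel_fst.
apply: locally_countable_and; first exact: borel_rel_snd.
apply: locally_countable_and; first exact: borel_not.
exact: locally_countable_walk_le.
Qed.

Lemma locally_countable_cell_of : locally_countable (cell_of G r U).
Proof.
apply: (@eq_locally_countable _ (fun x y => exists i, U i x /\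
    exists m, walk (piece_graph G r U i) m x y)) => [x y|].
  by split=> [[i [Ux xy]]|[i Ux xy]]; exists i.
apply: locally_countable_exists => i; apply: locally_countable_and.
  exact: borel_rel_fst.
apply: locally_countable_exists => m.
by apply: locally_countable_walk => //; exact: locally_countable_piece_graph.
Qed.

Lemma locally_countable_cell_nbhd n :
  locally_countable (fun x => cell_nbhd G r U n (cell_of G r U x)).
Proof.
have lc_cell := locally_countable_cell_of.
apply: eq_locally_countable
  (fun x y => iff_sym (cell_nbhd_cell_of witU n x y)) _.
apply: locally_countable_comp => //; apply: locally_countable_walk_le => //.
apply: locally_countable_and; first exact: borel_not lc_cell.1.
apply: locally_countable_comp => //; apply: locally_countable_comp => //.
exact: locally_countable_walk_le.
Qed.

End locally_countable_cells.

(** * Borel colorings from local rules *)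

Definition finitely_decided (X : topologicalType) (Q : X -> X -> Prop) : Prop :=
  exists (J : finType) (B : J -> set X), (forall j, borel (B j)) /\
    forall x x', (forall j, B j x <-> B j x') -> Q x x'.

Section finitely_decided.
Context {X : topologicalType}.
Implicit Types Q : X -> X -> Prop.

Lemma sub_finitely_decided Q Q' : (forall x x', Q x x' -> Q' x x') ->
  finitely_decided Q -> finitely_decided Q'.
Proof. by move=> QQ' [J [B [bB BQ]]]; exists J, B; split=> // x x' /BQ/QQ'. Qed.

Lemma finitely_decided_iff (A : set X) : borel A ->
  finitely_decided (fun x x' => A x <-> A x').
Proof. by move=> bA; exists unit, (fun=> A); split=> // x x' /(_ tt). Qed.

Lemma finitely_decided_forall (I : finType) (Q : I -> X -> X -> Prop) :
  (forall i, finitely_decided (Q i)) ->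
  finitely_decided (fun x x' => forall i, Q i x x').
Proof.
move=> decQ.
have /choice[B decB] : forall i, exists B : {J : finType & J -> set X},
    (forall j, borel (tagged B j)) /\
    forall x x', (forall j, tagged B j x <-> tagged B j x') -> Q i x x'.
  by move=> i; have [J [B decB]] := decQ i; exists (existT _ J B).
exists {i : I & tag (B i)}, (fun ij => tagged (B (tag ij)) (tagged ij)); split.
  by move=> ij; exact: (decB _).1.
move=> x x' same i; apply: (decB i).2 => j.
exact: (same (Tagged (fun i => tag (B i)) j)).
Qed.

Lemma finitely_decided_and Q Q' : finitely_decided Q -> finitely_decided Q' ->
  finitely_decided (fun x x' => Q x x' /\ Q' x x').
Proof.
move=> decQ decQ'.
apply: (@sub_finitely_decided
  (fun x x' => forall b : bool, (if b then Q else Q') x x')).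
  by move=> x x' QQ'; split; [exact: (QQ' true)|exact: (QQ' false)].
by apply: finitely_decided_forall => -[].
Qed.

Lemma borel_finitely_decided Q (H : Type) (c : X -> H) (S : set X)
    (A : set H) :
  finitely_decided Q -> borel S ->
  (forall x x', S x -> S x' -> Q x x' -> c x = c x') ->
  borel [set x | S x /\ A (c x)].
Proof.
move=> [J [B [bB BQ]]] bS Qc.
pose atom (t : {ffun J -> bool}) x := forall j, B j x <-> t j.
apply: (@eq_borel _ (fun x => exists t,
    (exists x0, [/\ S x0, A (c x0) & atom t x0]) /\ (S x /\ atom t x))) => [x|].
  split=> [[t [[x0 [Sx0 Ax0 tx0]] [Sx tx]]]|[Sx Ax]].
    split=> //; rewrite (Qc x x0)//; apply: BQ => j.
    exact: iff_trans (tx j) (iff_sym (tx0 j)).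
  have tx : atom [ffun j => `[< B j x >]] x.
    by move=> j; rewrite ffunE; split=> /asboolP.
  by exists [ffun j => `[< B j x >]]; split=> //; exists x.
apply: borel_exists => t; apply: borel_and; first exact: borel_const.
apply: borel_and => //; apply: borel_forall => j.
by apply: borel_and; apply: borel_imply; by [exact: bB|exact: borel_const].
Qed.

End finitely_decided.

Lemma exists_range_matching (V V' I : Type) (W : set V) (W' : set V')
    (e : I -> V) (e' : I -> V') : W = range e -> W' = range e' ->
  exists f : W -> W', forall y, exists2 i, val y = e i & val (f y) = e' i.
Proof.
move=> WE W'E.
suff /choice[f fP] : forall y : W, exists y' : W',
  exists2 i, val y = e i & val y' = e' i by exists f.
move=> [y Wy]; have [i _ ei] : range e y by rewrite -WE; exact: set_mem.
have W'ei : W' (e' i) by rewrite W'E; exists i.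
by exists (exist _ (e' i) (mem_set W'ei)), i.
Qed.

Section asi_coloring.
Context {L : language} {V : Type} (G : sgraph L V) {s : nat} (r : nat)
  (U : 'I_s.+1 -> set V) (witU : asi_witness G r U) (n : nat)
  (lt : V -> V -> Prop) (linlt : linear_order lt) (A : asi_algorithm s).
Local Notation cell := (cell_of G r U).
Local Notation W x := (cell_nbhd G r U n (cell x)).

Record same_pattern (I : finType) (x x' : V) (e e' : I -> V) : Prop :=
    SamePattern {
  pattern_center : forall i, e i = x <-> e' i = x';
  pattern_cell : forall i, cell x (e i) <-> cell x' (e' i);
  pattern_part : forall a i, U a (e i) <-> U a (e' i);
  pattern_eq : forall i j, e i = e j <-> e' i = e' j;
  pattern_lt : forall i j, lt (e i) (e j) <-> lt (e' i) (e' j);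
  pattern_adj : forall i j, adj G (e i) (e j) <-> adj G (e' i) (e' j);
  pattern_rels : forall R (v : {ffun 'I_(arity R) -> I}),
    rels G R (e \o v) <-> rels G R (e' \o v) }.

Lemma asi_coloring_same_pattern (I : finType) x x' (e e' : I -> V) :
  W x = range e -> W x' = range e' -> same_pattern x x' e e' ->
  asi_coloring witU n linlt A x = asi_coloring witU n linlt A x'.
Proof.
move=> We We' same; have [f fP] := exists_range_matching We We'.
have [g gP] := exists_range_matching We' We.
apply: (@asi_run_iso _ A _ _ _ _ _ f); last first.
  have [i xi fi] := fP (val (cell_point witU n linlt x)).
  by apply: val_inj; rewrite fi; apply/(pattern_center same)/esym.
split; first split.
- exists g => y.
    have [i yi fi] := fP y; have [j fj gj] := gP (f y).
    by apply: val_inj; rewrite gj yi; apply/(pattern_eq same); rewrite -fj.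
  have [i yi gi] := gP y; have [j gj fj] := fP (g y).
  by apply: val_inj; rewrite fj yi; apply/(pattern_eq same); rewrite -gj.
- move=> y z; have [i yi fi] := fP y; have [j zj fj] := fP z.
  by rewrite /= /induced_adj yi zj fi fj; exact: (pattern_adj same).
- move=> R v /=; have /choice[w wP] : forall a, exists i, val (v a) = e i /\
      val (f (v a)) = e' i by move=> a; have [i] := fP (v a); exists i.
  have -> : (fun a => val (v a)) = e \o finfun w.
    by apply/funext => a; rewrite /= ffunE (wP a).1.
  have -> : (fun a => val (f (v a))) = e' \o finfun w.
    by apply/funext => a; rewrite /= ffunE (wP a).2.
  exact: (pattern_rels same).
- move=> y z; have [i yi fi] := fP y; have [j zj fj] := fP z.
  by rewrite /= yi zj fi fj; exact: (pattern_lt same).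
- move=> a y; have [i yi fi] := fP y.
  by rewrite /= yi fi; exact: (pattern_part same).
- move=> y; have [i yi fi] := fP y.
  by rewrite /= yi fi; exact: (pattern_cell same).
Qed.

End asi_coloring.

Lemma finite_set_range_tnth (T : choiceType) (I : Type) (F : I -> T)
    (S : set T) :
  finite_set S -> (forall y, S y -> exists i, y = F i) ->
  exists m (t : m.-tuple I), S = range (fun k => F (tnth t k)).
Proof.
move=> /finite_seqP[u ->] coverS.
have [t ->] : exists t, u = map F t.
  elim: u coverS => [|y u IH] coverS; first by exists [::].
  have [i ->] := coverS y (mem_head y u).
  have [|t ->] := IH; last by exists (i :: t).
  by move=> z zu; apply: coverS; rewrite /= inE zu orbT.
exists (size t), (in_tuple t); apply/seteqP; split=> [y|_ [k _ <-]] /=.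
  move=> /(tnthP (map_tuple F (in_tuple t)))[k ->].
  by exists k; rewrite ?tnth_map.
by apply/(tnthP (map_tuple F (in_tuple t))); exists k; rewrite tnth_map.
Qed.

Lemma borel_section_eq_range (T : topologicalType) (E : T -> T -> Prop)
    (I : finType) (e : I -> T -> T) :
  @second_countable T -> borel_rel (@eq T) -> locally_countable E ->
  (forall i, borel_map (e i)) ->
  borel [set x | [set y | E x y] = range (e^~ x)].
Proof.
move=> countT borel_eq [bE [J [F [bF coverE]]]] be.
apply: (@eq_borel _ (fun x => (forall i, E x (e i x)) /\
    forall j, E x (F j x) -> exists i, e i x = F j x)) => [x|].
  split=> [[Ee EF]|Ex].
    apply/seteqP; split=> [y /= Exy|_ [i _ <-]]; last exact: Ee.
    have [j yj] := coverE _ _ Exy; rewrite yj in Exy *.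
    by have [i ei] := EF j Exy; exists i.
  split=> [i|j EF].
    have : range (e^~ x) (e i x) by exists i.
    by rewrite -Ex.
  have : range (e^~ x) (F j x) by rewrite -Ex.
  by move=> [i _ ei]; exists i.
apply: borel_and.
  apply: borel_forall => i.
  exact: borel_map_rel countT (@borel_map_id T) (be i) bE.
apply: borel_forall => j; apply: borel_imply.
  exact: borel_map_rel countT (@borel_map_id T) (bF j) bE.
apply: borel_exists => i.
exact: borel_map_rel countT (be i) (bF j) borel_eq.
Qed.

Lemma linear_order_eq (V : Type) (lt : V -> V -> Prop) x y : linear_order lt ->
  x = y <-> ~ lt x y /\ ~ lt y x.
Proof.
move=> [irr _ total]; split=> [->|[nxy nyx]]; first by split; exact: irr.
by case: (total x y).
Qed.

Section borel_asi_coloring.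
Context {L : language} {T : topologicalType} (G : sgraph L T)
  {s : nat} (r n : nat) (U : 'I_s.+1 -> set T) (witU : asi_witness G r U)
  (lt : T -> T -> Prop) (linlt : linear_order lt).
Hypotheses (countT : @second_countable T) (borel_lt : borel_rel lt)
  (borelG : borel_sgraph G) (borelU : forall i, borel (U i))
  (covered_adj : borel_covered (adj G)).

Let borel_eq : borel_rel (@eq T).
Proof.
apply: (@eq_borel _ (fun p => ~ lt p.1 p.2 /\ ~ lt p.2 p.1)) => [p|].
  exact: iff_sym (linear_order_eq _ _ linlt).
have borel_fst := @borel_map_fst T T; have borel_snd := @borel_map_snd T T.
by apply: borel_and; apply: borel_not; exact: borel_map_rel countT _ _ borel_lt.
Qed.

Let adj_lc : locally_countable (adj G).
Proof. by split=> //; exact: borelG.1. Qed.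

Lemma finitely_decided_same_pattern (I : finType) (e : I -> T -> T) :
  (forall i, borel_map (e i)) ->
  finitely_decided (fun x x' => same_pattern G r U lt x x' (e^~ x) (e^~ x')).
Proof.
move=> be; have borel_id := @borel_map_id T; have [borel_adj _] := borelG.
have lc_cell := locally_countable_cell_of r countT borel_eq borelU adj_lc.
have decided_pairs (E : T -> T -> Prop) : borel_rel E ->
    finitely_decided (fun x x' => forall i j,
      E (e i x) (e j x) <-> E (e i x') (e j x')).
  move=> bE; apply: finitely_decided_forall => i.
  apply: finitely_decided_forall => j; apply: finitely_decided_iff.
  exact: borel_map_rel countT (be i) (be j) bE.
apply: (@sub_finitely_decided _ (fun x x' =>
    (forall i, e i x = x <-> e i x' = x') /\
    (forall i, cell_of G r U x (e i x) <-> cell_of G r U x' (e i x')) /\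
    (forall a i, U a (e i x) <-> U a (e i x')) /\
    (forall i j, e i x = e j x <-> e i x' = e j x') /\
    (forall i j, lt (e i x) (e j x) <-> lt (e i x') (e j x')) /\
    (forall i j, adj G (e i x) (e j x) <-> adj G (e i x') (e j x')) /\
    forall R (v : {ffun 'I_(arity R) -> I}),
      rels G R ((e^~ x) \o v) <-> rels G R ((e^~ x') \o v))).
  by move=> x x' [? [? [? [? [? [? ?]]]]]].
apply: finitely_decided_and.
  apply: finitely_decided_forall => i; apply: finitely_decided_iff.
  exact: borel_map_rel countT (be i) borel_id borel_eq.
apply: finitely_decided_and.
  apply: finitely_decided_forall => i.
  apply: (@finitely_decided_iff _ [set x | cell_of G r U x (e i x)]).
  exact: borel_map_rel countT borel_id (be i) lc_cell.1.
apply: finitely_decided_and.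
  apply: finitely_decided_forall => a; apply: finitely_decided_forall => i.
  by apply: finitely_decided_iff; exact: be (borelU a).
do 3 (apply: finitely_decided_and; first exact: decided_pairs).
apply: finitely_decided_forall => R; apply: finitely_decided_forall => v.
apply: (@finitely_decided_iff _ [set x | rels G R ((e^~ x) \o v)]).
exact: (borel_map_ptws countT (fun i => be (v i))) (borelG.2 R).
Qed.

Theorem borel_asi_coloring (A : asi_algorithm s) :
  borel_coloring (asi_coloring witU n linlt A).
Proof.
move=> B; set c := asi_coloring _ _ _ _.
pose W x : set T := cell_nbhd G r U n (cell_of G r U x).
have lcW : locally_countable W by exact: locally_countable_cell_nbhd.
have [_ [I [F [bF coverW]]]] := lcW.
apply: (@eq_borel _ (fun x => exists m (t : m.-tuple I),
    W x = range (fun k => F (tnth t k) x) /\ B (c x))) => [x|].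
  split=> [[m [t []]]//|Bx].
  have finW : finite_set (W x).
    by apply: cell_nbhd_finite => //; exact: cells_cell_of.
  by have [m [t Wt]] := finite_set_range_tnth finW (coverW x); exists m, t.
apply: borel_exists => m; apply: borel_exists => t.
pose e k := F (tnth t k).
have be k : borel_map (e k) by exact: bF.
apply: (@borel_finitely_decided _ _ _ c [set x | W x = range (e^~ x)]
  B (finitely_decided_same_pattern be)).
  exact: (borel_section_eq_range countT borel_eq lcW be).
by move=> x x' Wx Wx'; exact: asi_coloring_same_pattern.
Qed.

End borel_asi_coloring.

Lemma asi_witness_widen (L : language) (V : Type) (G : sgraph L V) (m s r : nat)
    (U : 'I_m.+1 -> set V) : m <= s -> asi_witness G r U ->
  asi_witness G r (fun j : 'I_s.+1 => if j <= m then U (inord j) else set0).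
Proof.
move=> ms [[triv cov] fin]; split; first split.
- move=> i j _ _ [x []]; case: ifP => // im Ui; case: ifP => // jm Uj.
  apply: val_inj; have := triv _ _ I I (ex_intro _ x (conj Ui Uj)).
  by move=> /(congr1 val); rewrite /= !inordK.
- apply/seteqP; split=> // x _.
  have [i _ Ui] : (\bigcup_i U i) x by rewrite cov.
  have im : i <= m by rewrite -ltnS.
  exists (inord i) => //; rewrite inordK ?im ?inord_val// ltnS.
  exact: leq_trans im ms.
- move=> j x; rewrite /piece_graph; case: ifP => // jm; exact: fin.
Qed.

Theorem theorem2p9 (R : realType) (s : nat) (P : coloring_problem) :
  ASI s P -> asi R s P.
Proof.
move=> [A [n [r solves]]] L T G polT borelG GammaG /least_leP[m ms /(_ r)].
move=> [U [witU borelU]].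
have [lt linlt borel_lt] := polish_borel_linear_order polT.
have covered_adj := polish_finite_sections_covered polT borelG.1
  (@adj_locally_finite _ _ G).
exists (asi_coloring (asi_witness_widen ms witU) n linlt A); last exact: solves.
apply: borel_asi_coloring => // [|i]; first exact: polish_second_countable polT.
by case: ifP => _; [exact: borelU|exact: borel_const].
Qed.
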